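(* Let $G$ be a connected, simply connected, non-Abelian and nilpotent Lie group with Lie algebra $\mathfrak{g}$, and let $n=\dim\mathfrak{g}/[\mathfrak{g},\mathfrak{g}]$. Then there exist left-invariant Riemannian metrics $g$ on $G$ such that the natural group epimorphism $\Phi:(G,g)\to\mathbb{R}^n$ is a Riemannian submersion onto the standard Euclidean space $\mathbb{R}^n$. For any such $g$, if $V$ is a maximal isotropic subspace of $\mathbb{C}^n$, then $$\Omega_V=\{\phi_v:G\to\mathbb{C},\ \phi_v(x)=(\Phi(x),v)\mid v\in V\}$$ is an orthogonal family of globally defined harmonic morphisms on $(G,g)$.
   Context: Natural group epimorphism: fix a Lie algebra isomorphism $\psi:\mathfrak{g}/[\mathfrak{g},\mathfrak{g}]\to\mathbb{R}^n$ (both are Abelian); $\Phi:G\to\mathbb{R}^n$ is the unique Lie group homomorphism whose differential at $e$ is the composition of the projection $\mathfrak{g}\to\mathfrak{g}/[\mathfrak{g},\mathfrak{g}]$ with $\psi$. $(\cdot,\cdot)$ denotes the standard symmetric complex bilinear form on $\mathbb{C}^n$. A subspace of $\mathbb{C}^n$ is isotropic if the form vanishes identically on it; maximal isotropic means maximal among isotropic subspaces. For complex-valued functions on a Riemannian manifold $(M,g)$, $\tau$ is the Laplacian and $\kappa(\phi,\psi)=g(\operatorname{grad}\phi,\operatorname{grad}\psi)$, where $g$ is extended complex bilinearly to $T^{\mathbb{C}}M$. A function $\phi:M\to\mathbb{C}$ is a harmonic morphism if and only if $\tau(\phi)=0$ and $\kappa(\phi,\phi)=0$. A set $\Omega$ of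 functions $M\to\mathbb{C}$ is an orthogonal family of harmonic morphisms if $\tau(\phi)=0$ and $\kappa(\phi,\psi)=0$ for all $\phi,\psi\in\Omega$. *)

(* Defs.v *)
From HB Require Import structures.
From mathcomp Require Import all_boot all_order all_algebra.
From mathcomp Require Import all_classical all_reals all_analysis.
From mathcomp Require Import complex.
Set Implicit Arguments.
Unset Strict Implicit.
Unset Printing Implicit Defensive.
Import Order.TTheory GRing.Theory Num.Theory.
Import numFieldNormedType.Exports.
Local Open Scope classical_set_scope.
Local Open Scope ring_scope.
Local Open Scope complex_scope.

Section Smooth.
Context {R : realType} {V W : normedModType R}.

(* C^k on an open set A, by iterated directional derivatives; for finite
   dimensional V this is the usual notion. *)
Fixpoint Ck_on (k : nat) (A : set V) (f : V -> W) : Prop :=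
  (forall x, A x -> {for x, continuous f}) /\
  (if k is k'.+1 then
     forall v, (forall x, A x -> derivable f x v) /\ Ck_on k' A ('D_v f)
   else True).

Definition smooth_on (A : set V) (f : V -> W) : Prop :=
  forall k, Ck_on k A f.

End Smooth.

(* A homeomorphism from the open set chart_dom of M onto the open set
   chart_img of R^m; both maps are total, with junk values elsewhere. *)
Record chart (R : realType) (m : nat) (M : topologicalType) := Chart {
  chart_dom : set M ;
  chart_img : set 'rV[R]_m ;
  chart_fun : M -> 'rV[R]_m ;
  chart_inv : 'rV[R]_m -> M ;
  chart_dom_open : open chart_dom ;
  chart_img_open : open chart_img ;
  chart_fun_img : forall p, chart_dom p -> chart_img (chart_fun p) ;
  chart_inv_dom : forall x, chart_img x -> chart_dom (chart_inv x) ;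
  chart_funK : forall p, chart_dom p -> chart_inv (chart_fun p) = p ;
  chart_invK : forall x, chart_img x -> chart_fun (chart_inv x) = x ;
  chart_fun_cts : forall p, chart_dom p -> {for p, continuous chart_fun} ;
  chart_inv_cts : forall x, chart_img x -> {for x, continuous chart_inv}
}.

(* Smooth m-manifolds (Hausdorff, second countable).  The smooth structure is
   the one generated by the atlas {chart_at p | p in M}, which has a
   distinguished chart around each point.  The tangent space at p is 'rV[R]_m,
   a tangent vector being given by its components in the chart chart_at p. *)
HB.mixin Record isManifold (R : realType) (m : nat) M & Topological M := {
  manifold_hausdorff : hausdorff_space M ;
  manifold_second_countable : @second_countable M ;
  chart_at : M -> chart R m M ;
  chart_at_dom : forall p, chart_dom (chart_at p) p ;
  chart_transition : forall p q : M,
    smooth_on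
      [set x | chart_img (chart_at p) x /\
               chart_dom (chart_at q) (chart_inv (chart_at p) x)]
      (chart_fun (chart_at q) \o chart_inv (chart_at p))
}.

#[short(type="manifoldType")]
HB.structure Definition Manifold (R : realType) (m : nat) :=
  { M of isManifold R m M & Topological M }.

HB.mixin Record isLieGroup (R : realType) (m : nat) G
    & Group G & Manifold R m G := {
  lie_mul_cts : continuous (fun xy : G * G => (xy.1 * xy.2)%g) ;
  lie_inv_cts : continuous (fun x : G => (x^-1)%g) ;
  lie_mul_smooth : forall a b c : G,
    smooth_on
      [set xy : 'rV[R]_m * 'rV[R]_m |
         [/\ chart_img (chart_at a) xy.1, chart_img (chart_at b) xy.2 &
             chart_dom (chart_at c) (chart_inv (chart_at a) xy.1 *
                                     chart_inv (chart_at b) xy.2)%g]]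
      (fun xy => chart_fun (chart_at c) (chart_inv (chart_at a) xy.1 *
                                         chart_inv (chart_at b) xy.2)%g) ;
  lie_inv_smooth : forall a b : G,
    smooth_on
      [set x | chart_img (chart_at a) x /\
               chart_dom (chart_at b) (chart_inv (chart_at a) x)^-1%g]
      (fun x => chart_fun (chart_at b) (chart_inv (chart_at a) x)^-1%g)
}.

#[short(type="lieGroupType")]
HB.structure Definition LieGroup (R : realType) (m : nat) :=
  { G of isLieGroup R m G & Group G & Manifold R m G }.

Section ManifoldCalculus.
Context {R : realType} {m : nat} {M : manifoldType R m}.

Definition smooth_fun {W : normedModType R} (f : M -> W) : Prop :=
  forall p : M, smooth_on (chart_img (chart_at p)) (f \o chart_inv (chart_at p)).

(* df_p(v), for a function f with values in a normed space *)
Definition dfun {W : normedModType R} (f : M -> W) (p : M) (v : 'rV[R]_m) : W :=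
  'D_v (f \o chart_inv (chart_at p)) (chart_fun (chart_at p) p).

Definition vf_apply {W : normedModType R} (X : M -> 'rV[R]_m) (f : M -> W)
  : M -> W := fun p => dfun f p (X p).

(* [X, Y]^k = X(Y x^k) - Y(X x^k), x^k the coordinate functions of chart_at p *)
Definition vf_bracket (X Y : M -> 'rV[R]_m) (p : M) : 'rV[R]_m :=
  vf_apply X (vf_apply Y (chart_fun (chart_at p))) p -
  vf_apply Y (vf_apply X (chart_fun (chart_at p))) p.

(* The i-th coordinate vector field of the chart c at the point chart_inv c x,
   as a tangent vector, i.e. expressed in the distinguished chart there. *)
Definition coord_vector (c : chart R m M) (i : 'I_m) (x : 'rV[R]_m) : 'rV[R]_m :=
  'D_(delta_mx 0 i) (chart_fun (chart_at (chart_inv c x)) \o chart_inv c) x.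

Definition inner (g : M -> 'M[R]_m) (p : M) (u v : 'rV[R]_m) : R :=
  (u *m g p *m v^T) 0 0.

Definition metric_in (g : M -> 'M[R]_m) (c : chart R m M) (x : 'rV[R]_m)
  : 'M[R]_m :=
  \matrix_(i, j) inner g (chart_inv c x) (coord_vector c i x) (coord_vector c j x).

End ManifoldCalculus.

Definition tangent_map {R : realType} {m n : nat} {M : manifoldType R m}
    {N : manifoldType R n} (F : M -> N) (p : M) (v : 'rV[R]_m) : 'rV[R]_n :=
  dfun (chart_fun (chart_at (F p)) \o F) p v.

Record riemannian_metric (R : realType) (m : nat) (M : manifoldType R m) :=
  RiemannianMetric {
    metric_mx :> M -> 'M[R]_m ;
    metric_sym : forall p, (metric_mx p)^T = metric_mx p ;
    metric_pos : forall p u, u != 0 -> 0 < inner metric_mx p u u ;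
    metric_smooth : forall (p : M) (i j : 'I_m),
      smooth_on (chart_img (chart_at p))
        (fun x => metric_in metric_mx (chart_at p) x i j : R^o)
  }.

Section RiemannianOperators.
Context {R : realType} {m : nat} {M : manifoldType R m}.
Variable g : riemannian_metric M.

Definition grad (f : M -> R) (p : M) : 'rV[R]_m :=
  (\row_i dfun (f : M -> R^o) p (delta_mx 0 i)) *m invmx (g p).

Definition partial (i : 'I_m) (h : 'rV[R]_m -> R) : 'rV[R]_m -> R :=
  'D_(delta_mx 0 i) (h : 'rV[R]_m -> R^o).

(* Christoffel symbols Gamma^k_ij of the Levi-Civita connection in c *)
Definition christoffel (c : chart R m M) (k i j : 'I_m) (x : 'rV[R]_m) : R :=
  2^-1 * \sum_l invmx (metric_in g c x) k l *
    (partial i (fun y => metric_in g c y j l) x +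
     partial j (fun y => metric_in g c y i l) x -
     partial l (fun y => metric_in g c y i j) x).

(* (nabla df)(d_i, d_j) in c *)
Definition hessian (f : M -> R) (c : chart R m M) (i j : 'I_m) (x : 'rV[R]_m) : R :=
  partial i (partial j (f \o chart_inv c)) x -
  \sum_k christoffel c k i j x * partial k (f \o chart_inv c) x.

(* The Laplace-Beltrami operator, as the g-trace of nabla df *)
Definition laplacian (f : M -> R) (p : M) : R :=
  let c := chart_at p in
  let x := chart_fun c p in
  \sum_i \sum_j invmx (metric_in g c x) i j * hessian f c i j x.

Definition re_part (phi : M -> R[i]) : M -> R := fun p => complex.Re (phi p).
Definition im_part (phi : M -> R[i]) : M -> R := fun p => complex.Im (phi p).

Definition tau (phi : M -> R[i]) (p : M) : R[i] :=
  laplacian (re_part phi) p +i* laplacian (im_part phi) p.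

Definition gradC (phi : M -> R[i]) (p : M) : 'rV[R[i]]_m :=
  \row_k (grad (re_part phi) p 0 k +i* grad (im_part phi) p 0 k).

(* the metric is extended complex bilinearly *)
Definition kappa (phi psi : M -> R[i]) (p : M) : R[i] :=
  (gradC phi p *m map_mx (real_complex R) (g p) *m (gradC psi p)^T) 0 0.

Definition smooth_funC (phi : M -> R[i]) : Prop :=
  smooth_fun (re_part phi : M -> R^o) /\ smooth_fun (im_part phi : M -> R^o).

(* Complex-valued harmonic morphisms, through the Fuglede-Ishihara
   characterization: harmonic and horizontally weakly conformal. *)
Definition harmonic_morphism (phi : M -> R[i]) : Prop :=
  [/\ smooth_funC phi, forall p, tau phi p = 0 & forall p, kappa phi phi p = 0].

Definition orthogonal_family (Omega : set (M -> R[i])) : Prop :=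
  (forall phi, Omega phi -> harmonic_morphism phi) /\
  (forall phi psi, Omega phi -> Omega psi -> forall p, kappa phi psi p = 0).

Definition horizontal {n : nat} (F : M -> 'rV[R]_n) (p : M) (u : 'rV[R]_m) : Prop :=
  forall w, dfun F p w = 0 -> inner g p u w = 0.

(* Riemannian submersion onto R^n with its standard Euclidean metric *)
Definition riemannian_submersion {n : nat} (F : M -> 'rV[R]_n) : Prop :=
  [/\ smooth_fun F,
      forall y, exists p, F p = y,
      forall p y, exists u, dfun F p u = y &
      forall p u v, horizontal F p u -> horizontal F p v ->
        (dfun F p u *m (dfun F p v)^T) 0 0 = inner g p u v].

End RiemannianOperators.

Definition simply_connected (R : realType) (T : topologicalType) : Prop :=
  (forall x y : T, exists gamma : R -> T,
     [/\ {within `[0, 1], continuous gamma}, gamma 0 = x & gamma 1 = y]) /\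
  (forall gamma : R -> T,
     {within `[0, 1], continuous gamma} -> gamma 0 = gamma 1 ->
     exists H : R * R -> T,
       [/\ {within `[0, 1] `*` `[0, 1], continuous H},
           forall t, 0 <= t <= 1 -> H (0, t) = gamma t,
           forall t, 0 <= t <= 1 -> H (1, t) = gamma 0 &
           forall s, 0 <= s <= 1 -> H (s, 0) = gamma 0 /\ H (s, 1) = gamma 0]).

Section LinearSpan.
Context {R : realType} {m : nat}.

Definition lin_span (A : set 'rV[R]_m) : set 'rV[R]_m :=
  [set x | exists (k : nat) (c : 'I_k -> R) (a : 'I_k -> 'rV[R]_m),
     (forall i, A (a i)) /\ x = \sum_i c i *: a i].

Definition coset (W : set 'rV[R]_m) (u : 'rV[R]_m) : set 'rV[R]_m :=
  [set x | W (x - u)].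

(* psi, restricted to the cosets of W, is a linear isomorphism from the
   quotient space R^m / W onto R^n *)
Definition quotient_iso {n : nat} (W : set 'rV[R]_m)
    (psi : set 'rV[R]_m -> 'rV[R]_n) : Prop :=
  [/\ forall (a : R) (u v : 'rV[R]_m),
        psi (coset W (a *: u + v)) = a *: psi (coset W u) + psi (coset W v),
      forall u v, psi (coset W u) = psi (coset W v) -> coset W u = coset W v &
      forall y, exists u, psi (coset W u) = y].

End LinearSpan.

Section LieAlgebra.
Context {R : realType} {m : nat}.
Variable G : lieGroupType R m.

(* The Lie algebra of G is T_1 G = 'rV[R]_m. *)
Definition left_field (u : 'rV[R]_m) : G -> 'rV[R]_m :=
  fun x => tangent_map (fun y : G => (x * y)%g) 1%g u.

Definition lie_bracket (u v : 'rV[R]_m) : 'rV[R]_m :=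
  vf_bracket (left_field u) (left_field v) 1%g.

Fixpoint lower_central (k : nat) : set 'rV[R]_m :=
  if k is k'.+1 then
    lin_span [set w | exists u v, lower_central k' v /\ w = lie_bracket u v]
  else setT.

Definition nilpotent_lie_group : Prop :=
  exists k, lower_central k = [set 0].

Definition derived_algebra : set 'rV[R]_m :=
  lin_span [set w | exists u v, w = lie_bracket u v].

Definition left_invariant (g : riemannian_metric G) : Prop :=
  forall (a p : G) (u v : 'rV[R]_m),
    let L := fun y : G => (a * y)%g in
    inner g (L p) (tangent_map L p u) (tangent_map L p v) = inner g p u v.

(* Phi is the Lie group homomorphism G -> (R^n, +) whose differential at the
   identity is u |-> psi (u + [g, g]). *)
Definition natural_epimorphism {n : nat} (psi : set 'rV[R]_m -> 'rV[R]_n)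
    (Phi : G -> 'rV[R]_n) : Prop :=
  [/\ smooth_fun Phi,
      forall x y, Phi (x * y)%g = Phi x + Phi y &
      forall u, dfun Phi 1%g u = psi (coset derived_algebra u)].

End LieAlgebra.

Section Isotropic.
Context {R : realType} {n : nat}.

Definition bilin (z w : 'rV[R[i]]_n) : R[i] := \sum_k z 0 k * w 0 k.

Definition isotropic (V : {vspace 'rV[R[i]]_n}) : Prop :=
  forall z w, z \in V -> w \in V -> bilin z w = 0.

Definition maximal_isotropic (V : {vspace 'rV[R[i]]_n}) : Prop :=
  isotropic V /\
  forall W : {vspace 'rV[R[i]]_n}, isotropic W -> (V <= W)%VS -> W = V.

Definition Omega {T : Type} (Phi : T -> 'rV[R]_n) (V : {vspace 'rV[R[i]]_n})
  : set (T -> R[i]) :=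
  [set phi | exists2 v, v \in V &
     phi = fun x => bilin (map_mx (real_complex R) (Phi x)) v].

End Isotropic.

(* Main.v *)
Require Import Defs.
From HB Require Import structures.
From mathcomp Require Import all_boot all_order all_algebra.
From mathcomp Require Import all_classical all_reals all_analysis.
From mathcomp Require Import complex.
From mathcomp Require Import ring lra.
Set Implicit Arguments.
Unset Strict Implicit.
Unset Printing Implicit Defensive.
Import Order.TTheory GRing.Theory Num.Theory.
Import numFieldNormedType.Exports.
Local Open Scope classical_set_scope.
Local Open Scope ring_scope.

(** The Laplacian of a smooth homomorphism f from G to the real line is computed in a
    chart from the left-invariant frame J. Since g is left-invariant, J g J^T is
    constant; since f is a homomorphism, so is J df. Differentiating both, the
    Laplacian of f at a point becomes a combination of the traces of the maps ad X,
    X left-invariant; these are nilpotent, hence traceless. The brackets of left-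
    invariant fields at an arbitrary point are compared with those at 1 by symmetry
    of the second derivatives of left translations.

    For a Riemannian submersion with differential B one has B^T g^-1 B = 1, so
    kappa of two functions phi_v and phi_w is the constant (v, w), which vanishes on
    an isotropic subspace.

    A metric making Phi a Riemannian submersion is the left-invariant extension of
    A A^T + K K^T, where A is the differential of Phi at 1 and K a projection onto its
    kernel. Phi is onto because its image is a subgroup of R^n which contains a ball
    around 0, by Newton's iteration (a contraction) along a linear section of A. *)

(** * Second differences and symmetry of second derivatives *)

Section Lines.
Context {R : realType} {V : normedModType R}.
Implicit Types (f : V -> R^o) (x v : V).

Lemma is_derive_line f x v (t : R) : derivable f (x + t *: v) v ->
  is_derive t 1 (fun s : R => f (x + s *: v)) ('D_v f (x + t *: v)).
Proof.
have E : (fun h : R =>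
    h^-1 *: (((fun s : R => f (x + s *: v)) \o shift t) (h *: 1) - f (x + t *: v))) =
  (fun h : R => h^-1 *: ((f \o shift (x + t *: v)) (h *: v) - f (x + t *: v))).
  apply/funext => h /=; congr (_ *: (f _ - _)).
  by rewrite [h *: 1]mulr1 scalerDl addrCA.
by move=> d; split; rewrite /derivable /derive E.
Qed.

(** The parameter [s] may have either sign, so the disjunction places a point between 0 and [s];
    each orientation reduces to the mean value theorem on an ordered interval. *)
Lemma mvt_line f x v (s : R) :
  (forall t : R, (0 <= t <= s) || (s <= t <= 0) -> derivable f (x + t *: v) v) ->
  exists2 c : R, (0 <= c <= s) || (s <= c <= 0) &
    f (x + s *: v) - f x = s * 'D_v f (x + c *: v).
Proof.
move=> df.
have dg (t : R) : (0 <= t <= s) || (s <= t <= 0) ->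
    is_derive t 1 (fun s : R => f (x + s *: v)) ('D_v f (x + t *: v)).
  by move=> /df; exact: is_derive_line.
have cg (t : R) : (0 <= t <= s) || (s <= t <= 0) ->
    {for t, continuous (fun s : R => f (x + s *: v))}.
  move=> /dg [d _]; apply: differentiable_continuous.
  by apply/derivable1_diffP.
have W (a b : R) : (forall t : R, t \in `[a, b]%R -> (0 <= t <= s) || (s <= t <= 0)) ->
    {within `[a, b], continuous (fun s : R => f (x + s *: v))}.
  move=> H; apply: continuous_in_subspaceT => t; rewrite inE => /H; exact: cg.
have [s0|s0] := leP 0 s.
  have H (t : R) : t \in `[0, s]%R -> (0 <= t <= s) || (s <= t <= 0).
    by rewrite in_itv => ->.
  have [|c /H c1 c2] := @MVT_segment R _ (fun t => 'D_v f (x + t *: v)) 0 s s0 _ (W _ _ H).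
    by move=> t /subset_itv_oo_cc /H; exact: dg.
  by exists c => //; move: c2; rewrite scale0r addr0 subr0 mulrC.
have H (t : R) : t \in `[s, 0]%R -> (0 <= t <= s) || (s <= t <= 0).
  by rewrite in_itv => ->; rewrite orbT.
have [|c /H c1 c2] := @MVT_segment R _ (fun t => 'D_v f (x + t *: v)) s 0 (ltW s0) _ (W _ _ H).
  by move=> t /subset_itv_oo_cc /H; exact: dg.
exists c => //; move: c2; rewrite scale0r addr0 sub0r => e.
by rewrite -opprB e mulrN opprK mulrC.
Qed.

Lemma ler_norm_between (t s : R) : (0 <= t <= s) || (s <= t <= 0) -> `|t| <= `|s|.
Proof.
case/orP=> /andP[a b]; first by rewrite !ger0_norm// (le_trans a).
by rewrite !ler0_norm ?lerN2// (le_trans a).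
Qed.

(** The mean value theorem is applied twice: along [u] to the increment [g] of [f] in the direction
    [s *: v], then along [v] to ['D_u f]. *)
Lemma second_difference f x u v (s : R) :
  (forall a b : R, `|a| <= `|s| -> `|b| <= `|s| ->
    derivable f (x + a *: u + b *: v) u /\
    derivable ('D_u f : V -> R^o) (x + a *: u + b *: v) v) ->
  exists c d : R, [/\ `|c| <= `|s|, `|d| <= `|s| &
   f (x + s *: u + s *: v) - f (x + s *: u) - f (x + s *: v) + f x =
   s * s * 'D_v ('D_u f : V -> R^o) (x + c *: u + d *: v)].
Proof.
move=> H.
have H0 (a : R) : `|a| <= `|s| -> derivable f (x + a *: u) u.
  by move=> as_; have [] := H a 0 as_; rewrite ?scale0r ?addr0 ?normr0.
pose g (y : V) := f (y + s *: v) - f y.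
have Dg (a : R) : `|a| <= `|s| -> is_derive (x + a *: u) u (g : V -> R^o)
   ('D_u f (x + a *: u + s *: v) - 'D_u f (x + a *: u)).
  move=> as_; apply: is_deriveB; last exact/derivableP/H0.
  have [d _] := H a s as_ (lexx _).
  split.
    move: d; rewrite /derivable.
    by under eq_fun do rewrite /= addrA.
  rewrite /derive.
  by under eq_fun do rewrite /= -addrA.
have [c /ler_norm_between cs Ec] := @mvt_line (g : V -> R^o) x u s
  (fun t ht => @ex_derive _ _ _ _ _ _ _ (Dg t (ler_norm_between ht))).
have [|d /ler_norm_between ds Ed] := @mvt_line ('D_u f : V -> R^o) (x + c *: u) v s.
  by move=> t /ler_norm_between ts; have [] := H c t cs ts.
exists c, d; split => //.
rewrite -mulrA -Ed; have := Ec; rewrite (@derive_val _ _ _ _ _ _ _ (Dg c cs)) => <-.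
by rewrite /g opprB addrA addrAC.
Qed.

(* Both mixed derivatives approximate the same second difference. *)
Lemma derive_comm f x u v :
  (\forall y \near x, [/\ derivable f y u, derivable f y v,
     derivable ('D_u f : V -> R^o) y v & derivable ('D_v f : V -> R^o) y u]) ->
  {for x, continuous ('D_v ('D_u f : V -> R^o))} ->
  {for x, continuous ('D_u ('D_v f : V -> R^o))} ->
  'D_v ('D_u f : V -> R^o) x = 'D_u ('D_v f : V -> R^o) x.
Proof.
move=> nf c1 c2; apply/eqP; rewrite -subr_eq0 -normr_le0.
apply/ler_addgt0Pl => e e0; rewrite addr0.
have e20 : 0 < e / 2 by rewrite divr_gt0.
have n1 : \forall t \near x,
    `|'D_v ('D_u f : V -> R^o) x - 'D_v ('D_u f : V -> R^o) t| <= e / 2.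
  by move/cvgrPdist_le: c1; apply.
have n2 : \forall t \near x,
    `|'D_u ('D_v f : V -> R^o) x - 'D_u ('D_v f : V -> R^o) t| <= e / 2.
  by move/cvgrPdist_le: c2; apply.
have NN := @filterI _ _ (nbhs_filter x) _ _ nf (@filterI _ _ (nbhs_filter x) _ _ n1 n2).
have [r /= r0 Br] := (nbhs_ballP _ _).1 NN.
(* Small enough that [x + a *: u + b *: v] stays in the ball of radius [r] whenever [a] and [b] are
   at most [s] in absolute value; the summand 1 keeps the denominator positive. *)
pose s := r / (1 + `|u| + `|v|).
have N0 : 0 < 1 + `|u| + `|v| by rewrite -addrA ltr_pwDl // addr_ge0.
have s0 : 0 < s by rewrite divr_gt0// mulr_gt0.
have B (a b : R) : `|a| <= `|s| -> `|b| <= `|s| -> ball x r (x + a *: u + b *: v).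
  rewrite (gtr0_norm s0) => as_ bs; rewrite -ball_normE /ball_/= -addrA opprD addNKr.
  rewrite normrN (le_lt_trans (ler_normD _ _))// !normrZ.
  rewrite (@le_lt_trans _ _ (s * `|u| + s * `|v|))//.
    by rewrite lerD// ler_wpM2r.
  by rewrite -mulrDr /s mulrAC ltr_pdivrMr// ltr_pM2l// -addrA ltrDr.
have [|a1 [b1 [a1s b1s E1]]] := @second_difference f x u v s.
  move=> a b ha hb; have [[h1 _ h3 _] _] := Br _ (B a b ha hb).
  by split; [exact: h1|exact: h3].
have [|a2 [b2 [a2s b2s E2]]] := @second_difference f x v u s.
  move=> a b ha hb; have [[_ h2 _ h4] _] := Br _ (B b a hb ha).
  by rewrite addrAC; split; [exact: h2|exact: h4].
have E : 'D_v ('D_u f : V -> R^o) (x + a1 *: u + b1 *: v) =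
         'D_u ('D_v f : V -> R^o) (x + a2 *: v + b2 *: u).
  move: E2; rewrite (addrAC x (s *: v)) [f _ - f (x + s *: v) - _]addrAC E1.
  by apply: mulfI; rewrite mulf_neq0 ?gt_eqF.
have [_ [h1 _]] := Br _ (B _ _ a1s b1s).
have [_ [_ h2]] := Br _ (B _ _ b2s a2s).
rewrite -(subrKA ('D_v ('D_u f : V -> R^o) (x + a1 *: u + b1 *: v))).
apply: (le_trans (ler_normD _ _)); rewrite [leRHS]splitr.
apply: lerD; first exact: h1.
by rewrite E distrC addrAC; exact: h2.
Qed.
End Lines.

(** * Differentiability of C^1 functions *)

Lemma differentiable_approx {R : realType} {V W : normedModType R} (f : V -> W)
    (L : {linear V -> W}) x : continuous L ->
  (forall e : R, 0 < e -> \forall h \near (0 : V),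
    `|f (h + x) - f x - L h| <= e * `|h|) -> differentiable f x.
Proof.
move=> Lc H.
have key : f \o shift x = cst (f x) + (L : V -> W) +o_ (0 : V) id.
  apply/eqaddoP => _/posnumP[e]; near=> h.
  rewrite /= !fctE opprD addrA; near: h; exact: H.
have dE : 'd f x = L :> (V -> W) by apply: diff_unique.
by apply/diff_locallyP; rewrite dE.
Unshelve. all: by end_near. Qed.

Section C1.
Context {R : realType} {m : nat}.
Implicit Types (f : 'rV[R]_m -> R^o) (x y z v : 'rV[R]_m).

Lemma ler_norm_coord {n p} (A : 'M[R]_(n, p)) i j : `|A i j| <= `|A|.
Proof.
by rewrite [leRHS]/Num.Def.normr /= mx_normrE;
  apply: (le_bigmax _ (fun k => `|A k.1 k.2|) (i, j)).
Qed.

(** One walks from [z] to [y] changing one coordinate at a time, with the mean value theorem on each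
    segment. The ball of the sup norm is a box, so the walk does not leave it. *)
Lemma lipschitz_partial f x (r e : R) : 0 <= e ->
  (forall z, ball x r z -> forall i,
     derivable f z (delta_mx 0 i) /\ `|'D_(delta_mx 0 i) f z| <= e) ->
  forall y z, ball x r y -> ball x r z -> `|f y - f z| <= m%:R * e * `|y - z|.
Proof.
move=> e0 H y z [r0 By] [_ Bz].
(* The first [k] coordinates come from [y] and the others from [z], so [w 0] is [z] and [w m] is
   [y]. *)
pose w (k : nat) : 'rV[R]_m := \row_j (if (j < k)%N then y 0 j else z 0 j).
have ym : y = w m by apply/rowP => j; rewrite mxE ltn_ord.
have z0 : z = w 0 by apply/rowP => j; rewrite mxE ltn0.
have -> : f y - f z = \sum_(k < m) (f (w k.+1) - f (w k)).
  by rewrite ym z0 -(big_mkord xpredT (fun k => f (w k.+1) - f (w k))) telescope_sumr.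
rewrite (le_trans (ler_norm_sum _ _ _))// -mulrA mulr_natl -[X in _ *+ X]card_ord -sumr_const.
apply: ler_sum => k _.
have wS : w k.+1 = w k + (y 0 k - z 0 k) *: delta_mx 0 k.
  apply/rowP => j; rewrite !mxE eqxx /= ltnS leq_eqVlt.
  have [->|jk] := eqVneq j k; first by rewrite eqxx ltnn mulr1 addrC subrK.
  by rewrite (negbTE (jk : (j : nat) != k)) mulr0 addr0.
have B (t : R) : (0 <= t <= y 0 k - z 0 k) || (y 0 k - z 0 k <= t <= 0) ->
    ball x r (w k + t *: delta_mx 0 k).
  move=> ht; split => // i j; rewrite ord1 !mxE eqxx /=.
  have := By 0 j; have := Bz 0 j; rewrite -!ball_normE /ball_ /=.
  have [->|jk] := eqVneq j k; last by rewrite mulr0 addr0; case: ifP.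
  rewrite ltnn mulr1 !ltr_norml => /andP[? ?] /andP[? ?].
  by case/orP: ht => /andP[? ?]; apply/andP; split; lra.
rewrite wS.
have [|c /B Bc ->] := @mvt_line R _ f (w k) (delta_mx 0 k) (y 0 k - z 0 k).
  by move=> t /B /H /(_ k) [].
rewrite normrM mulrC ler_pM//; first by have [] := H _ Bc k.
by have := @ler_norm_coord _ _ (y - z) 0 k; rewrite !mxE.
Qed.

Lemma ler_norm_coords (v : 'rV[R]_m) (a : R) :
  0 <= a -> (forall j, `|v 0 j| <= a) -> `|v| <= a.
Proof.
move=> a0 H; rewrite [leLHS]/Num.Def.normr /= mx_normrE.
apply/bigmax_leP; split => //= -[i j] _ /=.
by rewrite ord1.
Qed.

(** Subtracting the candidate differential [L] leaves a function whose partial derivatives are small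
    near [x]; its Lipschitz bound there is the required little-o estimate. *)
Lemma C1_differentiable (f : 'rV[R]_m -> R) x :
  (\forall y \near x, forall i, derivable f y (delta_mx 0 i)) ->
  (forall i, {for x, continuous ('D_(delta_mx 0 i) f : _ -> R)}) ->
  differentiable f x.
Proof.
move=> df cf.
pose L0 := fun h : 'rV[R]_m => (\sum_i h 0 i * 'D_(delta_mx 0 i) f x : R).
have L0lin : linear L0.
  move=> a u v; rewrite /L0 scaler_sumr -big_split /=; apply: eq_bigr => i _.
  by rewrite !mxE mulrDl -mulrA.
pose L : {linear 'rV[R]_m -> R} := HB.pack L0 (GRing.isLinear.Build _ _ _ _ _ L0lin).
have LE v : L v = L0 v by [].
have Lc : continuous L.
  move=> y; rewrite (_ : (L : _ -> _) =
      \sum_i (fun h : 'rV[R]_m => h 0 i * 'D_(delta_mx 0 i) f x : R)).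
    apply: differentiable_continuous; apply: differentiable_sum => i.
    apply: differentiableM => //; exact: differentiable_coord.
  by apply/funext => h; rewrite fct_sumE.
have Lder z i : is_derive z (delta_mx 0 i) L ('D_(delta_mx 0 i) f x).
  have dL : differentiable L z by apply: linear_differentiable.
  split; first exact: diff_derivable.
  rewrite deriveE// diff_lin// LE /L0 (bigD1 i)//= mxE !eqxx mul1r big1 ?addr0// => j ji.
  by rewrite mxE (negbTE ji) andbF mul0r.
apply: (differentiable_approx (L := L) Lc) => e e0.
pose ps : 'rV[R]_m -> R := fun y => f y - L y.
(* The Lipschitz constant [m%:R * e'] is then at most [e]; the added 1 covers [m = 0]. *)
pose e' := e / (m%:R + 1).
have m0 : 0 < m%:R + 1 :> R by rewrite ltr_wpDl.
have e'0 : 0 < e' by rewrite divr_gt0.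
have cf' : \forall y \near x, forall i,
    `|'D_(delta_mx 0 i) f x - 'D_(delta_mx 0 i) f y| <= e'.
  apply: (@filter_forall _ _
    (fun i y => `|'D_(delta_mx 0 i) f x - 'D_(delta_mx 0 i) f y| <= e') (nbhs x) _).
  by move=> i; have /cvgrPdist_le := cf i; apply.
have NN := @filterI _ _ (nbhs_filter x) _ _ df cf'.
have [r /= r0 Br] := (nbhs_ballP _ _).1 NN.
have nh : \forall h \near (0 : 'rV[R]_m), `|h| < r by exact: nbhs0_lt.
near=> h.
have -> : f (h + x) - f x - L h = ps (h + x) - ps x.
  by rewrite /ps linearD; ring.
rewrite (@le_trans _ _ (m%:R * e' * `|h + x - x|))//.
  apply: (@lipschitz_partial ps x r e' (ltW e'0)).
  - move=> z Bz i; have [dz ez] := Br z Bz.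
    have := @is_deriveB _ _ _ _ _ _ _ _ _ (derivableP (dz i)) (Lder z i).
    by move=> [? ->]; rewrite distrC.
  - rewrite -ball_normE /ball_/= opprD addrCA subrr addr0 normrN.
    by near: h.
  - exact: ballxx.
rewrite addrK ler_wpM2r// /e' mulrA ler_pdivrMr// mulrC ler_pM2l// lerDl.
Unshelve. all: by end_near. Qed.

Lemma differentiable_rowP {n} (f : 'rV[R]_m -> 'rV[R]_n) x :
  (forall j, differentiable (fun y => f y 0 j : R^o) x) -> differentiable f x.
Proof.
move=> H.
rewrite (_ : f = \sum_j (fun y => f y 0 j *: delta_mx 0 j)); last first.
  by apply/funext => y; rewrite fct_sumE [LHS]row_sum_delta.
by apply: differentiable_sum => j; apply: differentiableZl; exact: H.
Qed.
End C1.

(** * Closure properties of C^k functions *)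

Section CkGeneral.
Context {R : realType} {V W : normedModType R}.
Implicit Types (A : set V) (f g : V -> W).

Lemma open_near A x : open A -> A x -> \forall y \near x, A y.
Proof. by move=> oA Ax; apply: open_nbhs_nbhs. Qed.

Lemma near_eq_continuous f g x : (\forall y \near x, f y = g y) ->
  {for x, continuous f} -> {for x, continuous g}.
Proof.
move=> fg; rewrite /prop_for /continuous_at => cf.
rewrite -(nbhs_singleton fg); apply: cvg_trans cf.
by apply: near_eq_cvg; apply: filterS fg => y ->.
Qed.

(** As [A] is open, the two functions agree near each of its points and have the same derivatives
    there. This is what allows the junk values of charts to be ignored. *)
Lemma Ck_on_ext k A f g : open A -> (forall x, A x -> f x = g x) ->
  Ck_on k A f -> Ck_on k A g.
Proof.
move=> oA; elim: k f g => [|k IH] f g fg.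
  case=> cf _; split => // x Ax; apply: near_eq_continuous (cf x Ax).
  by apply: filterS (open_near oA Ax) => y /fg.
case=> cf df; split.
  move=> x Ax; apply: near_eq_continuous (cf x Ax).
  by apply: filterS (open_near oA Ax) => y /fg.
move=> v; have [d1 d2] := df v; split.
  move=> x Ax; apply: near_eq_derivable (d1 x Ax).
  by apply: filterS (open_near oA Ax) => y /fg.
apply: IH d2 => x Ax; apply: near_eq_derive.
by apply: filterS (open_near oA Ax) => y /fg.
Qed.

Lemma Ck_on_sub k A B f : B `<=` A -> Ck_on k A f -> Ck_on k B f.
Proof.
move=> BA; elim: k f => [|k IH] f [cf df]; split; try by move=> x /BA /cf.
  by [].
by move=> v; have [d1 d2] := df v; split; [move=> x /BA /d1|exact: IH].
Qed.

Lemma Ck_onW k A f : Ck_on k.+1 A f -> Ck_on k A f.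
Proof.
elim: k f => [|k IH] f [cf df]; split => // v.
by have [d1 d2] := df v; split => //; apply: IH.
Qed.

Lemma Ck_on_cst k A (w : W) : Ck_on k A (fun=> w).
Proof.
elim: k w => [|k IH] w; split;
  [by move=> x _; exact: cst_continuous|by []|by move=> x _; exact: cst_continuous|move=> v].
split; first by move=> x _; exact: derivable_cst.
have -> : 'D_v (fun=> w) = (fun=> 0) by apply/funext => x; exact: derive_cst.
exact: IH.
Qed.

Lemma Ck_onD k A f g : open A -> Ck_on k A f -> Ck_on k A g ->
  Ck_on k A (fun x => f x + g x).
Proof.
move=> oA; elim: k f g => [|k IH] f g [cf df] [cg dg].
  by split => // x Ax; apply: continuousD; [exact: cf|exact: cg].
split; first by move=> x Ax; apply: continuousD; [exact: cf|exact: cg].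
move=> v; have [f1 f2] := df v; have [g1 g2] := dg v; split.
  by move=> x Ax; apply: derivableD; [exact: f1|exact: g1].
apply: Ck_on_ext (IH _ _ f2 g2) => // x Ax; rewrite deriveD//; [exact: f1|exact: g1].
Qed.

Lemma Ck_on_comp_affine {U : normedModType R} k A f (T L : U -> V) :
  continuous L -> (forall (h : R) v x, L (h *: v + x) = h *: T v + L x) ->
  Ck_on k A f -> Ck_on k (L @^-1` A) (f \o L).
Proof.
move=> cL TL; elim: k f => [|k IH] f [cf df]; split => //.
- by move=> x /cf; apply: continuous_comp; exact: cL.
- by move=> x /cf; apply: continuous_comp; exact: cL.
move=> v; have [d1 d2] := df (T v).
have E x : (fun h : R => h^-1 *: ((f \o L \o shift x) (h *: v) - (f \o L) x)) =
   (fun h : R => h^-1 *: ((f \o shift (L x)) (h *: T v) - f (L x))).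
  by apply/funext => h; rewrite /= TL.
split; first by move=> x /d1; rewrite /derivable E.
have -> : 'D_v (f \o L) = 'D_(T v) f \o L by apply/funext => x; rewrite /derive E.
exact: IH.
Qed.

End CkGeneral.

(** * Products, inverses and determinants of C^k functions *)

Section CkScalar.
Context {R : realType} {V : normedModType R}.
Implicit Types (A : set V) (f g : V -> R^o).

Lemma Ck_on_coord {n p} k A (f : V -> 'M[R]_(n, p)) i j : open A -> Ck_on k A f ->
  Ck_on k A (fun x => f x i j : R^o).
Proof.
move=> oA; elim: k f => [|k IH] f [cf df]; split => //.
- by move=> x /cf cx; exact: (@continuous_comp _ _ _ f (fun M : 'M[R]_(n, p) => M i j : R^o) x cx
    (@coord_continuous _ _ _ i j _)).
- by move=> x /cf cx; exact: (@continuous_comp _ _ _ f (fun M : 'M[R]_(n, p) => M i j : R^o) x cx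
    (@coord_continuous _ _ _ i j _)).
move=> v; have [d1 d2] := df v; split.
  by move=> x /d1 /derivable_mxP.
apply: Ck_on_ext (IH _ d2) => // x /d1 dx.
by rewrite derive_mx// mxE.
Qed.

Lemma Ck_onM k A f g : open A -> Ck_on k A f -> Ck_on k A g ->
  Ck_on k A (fun x => f x * g x : R^o).
Proof.
move=> oA; elim: k f g => [|k IH] f g hf hg.
  case: hf hg => [cf _] [cg _].
  by split => // x Ax; apply: continuousM; [exact: cf|exact: cg].
have [cf df] := hf; have [cg dg] := hg.
split; first by move=> x Ax; apply: continuousM; [exact: cf|exact: cg].
move=> v; have [f1 f2] := df v; have [g1 g2] := dg v; split.
  by move=> x Ax; apply: derivableM; [exact: f1|exact: g1].
have H := Ck_onD oA (IH _ _ (Ck_onW hf) g2) (IH _ _ (Ck_onW hg) f2).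
refine (@Ck_on_ext _ _ R^o k A _ _ oA _ H) => x Ax.
exact: esym (deriveM (f1 x Ax) (g1 x Ax)).
Qed.

(** The derivative of the inverse involves the inverse again, but only to order [k], where the
    induction hypothesis applies. *)
Lemma Ck_onV k A f : open A -> (forall x, A x -> f x != 0) -> Ck_on k A f ->
  Ck_on k A (fun x => (f x)^-1 : R^o).
Proof.
move=> oA f0; elim: k => [|k IH] hf; have [cf df] := hf; split => //.
- by move=> x Ax; apply: continuousV; [exact: f0|exact: cf].
- by move=> x Ax; apply: continuousV; [exact: f0|exact: cf].
move=> v; have [f1 f2] := df v; split.
  by move=> x Ax; apply: derivableV; [exact: f0|exact: f1].
have H := IH (Ck_onW hf).
have H1 := Ck_onM oA (Ck_on_cst k A (-1 : R^o)) (Ck_onM oA (Ck_onM oA H H) f2).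
refine (@Ck_on_ext _ _ R^o k A _ _ oA _ H1) => x Ax.
apply: etrans (esym (deriveV (f0 x Ax) (f1 x Ax))).
have E (a b : R) : -1 * (a^-1 * a^-1 * b) = - a ^- 2 * b.
  by rewrite mulN1r expr2 invfM mulNr.
exact: E.
Qed.

Lemma Ck_on_sum k A (I : Type) (r : seq I) (P : pred I) (F : I -> V -> R^o) : open A ->
  (forall i, P i -> Ck_on k A (F i)) -> Ck_on k A (fun x => \sum_(i <- r | P i) F i x : R^o).
Proof.
move=> oA H; elim: r => [|i r IH].
  by under eq_fun do rewrite big_nil; exact: Ck_on_cst.
case Pi: (P i); under eq_fun do rewrite big_cons Pi; last by [].
by apply: Ck_onD => //; exact: H.
Qed.

Lemma Ck_on_prod k A (I : Type) (r : seq I) (P : pred I) (F : I -> V -> R^o) : open A ->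
  (forall i, P i -> Ck_on k A (F i)) ->
  Ck_on k A (fun x => \prod_(i <- r | P i) (F i x : R) : R^o).
Proof.
move=> oA H; elim: r => [|i r IH].
  by under eq_fun do rewrite big_nil; exact: Ck_on_cst.
case Pi: (P i); under eq_fun do rewrite big_cons Pi; last by [].
by apply: Ck_onM => //; exact: H.
Qed.

Lemma Ck_on_det k A n (F : V -> 'M[R]_n) : open A ->
  (forall i j, Ck_on k A (fun x => F x i j : R^o)) ->
  Ck_on k A (fun x => \det (F x) : R^o).
Proof.
move=> oA H; apply: Ck_on_sum => // s _; apply: Ck_onM => //; first exact: Ck_on_cst.
by apply: Ck_on_prod.
Qed.

Lemma Ck_on_mulmx k A n p q (F : V -> 'M[R]_(n, p)) (G : V -> 'M[R]_(p, q)) : open A ->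
  (forall i j, Ck_on k A (fun x => F x i j : R^o)) ->
  (forall i j, Ck_on k A (fun x => G x i j : R^o)) ->
  forall i j, Ck_on k A (fun x => (F x *m G x) i j : R^o).
Proof.
move=> oA HF HG i j; under eq_fun do rewrite mxE.
by apply: Ck_on_sum => // l _; apply: Ck_onM.
Qed.

(** Cramer's rule: an entry of the inverse is a cofactor divided by the determinant. *)
Lemma Ck_on_invmx k A n (F : V -> 'M[R]_n) : open A ->
  (forall i j, Ck_on k A (fun x => F x i j : R^o)) ->
  (forall x, A x -> F x \in unitmx) ->
  forall i j, Ck_on k A (fun x => invmx (F x) i j : R^o).
Proof.
move=> oA HF uF i j.
have HC : Ck_on k A (fun x => (\det (F x))^-1 * cofactor (F x) j i : R^o).
  apply: Ck_onM => //.
    apply: Ck_onV => //; last exact: Ck_on_det.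
    by move=> x /uF; rewrite unitmxE unitfE.
  apply: Ck_onM => //; first exact: Ck_on_cst.
  apply: Ck_on_det => // a b.
  by under eq_fun do rewrite !mxE.
apply: Ck_on_ext HC => // x Ax.
by rewrite /invmx uF// !mxE.
Qed.

End CkScalar.

Section Smooth.
Context {R : realType} {m : nat}.
Implicit Types (A : set 'rV[R]_m).

Lemma C1_on_differentiable A (f : 'rV[R]_m -> R^o) x : open A -> Ck_on 1 A f -> A x ->
  differentiable f x.
Proof.
move=> oA [cf df] Ax; apply: C1_differentiable.
  by apply: filterS (open_near oA Ax) => y Ay i; have [d _] := df (delta_mx 0 i); exact: d.
by move=> i; have [_ [d _]] := df (delta_mx 0 i); exact: d.
Qed.

Lemma C1_on_differentiable_row n A (f : 'rV[R]_m -> 'rV[R]_n) x :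
  open A -> Ck_on 1 A f -> A x -> differentiable f x.
Proof.
move=> oA cf Ax; apply: differentiable_rowP => j.
by apply: (C1_on_differentiable oA _ Ax); apply: Ck_on_coord.
Qed.

Lemma C2_derive_comm A (f : 'rV[R]_m -> R^o) x u v : open A -> Ck_on 2 A f -> A x ->
  'D_v ('D_u f : _ -> R^o) x = 'D_u ('D_v f : _ -> R^o) x.
Proof.
move=> oA [_ df] Ax.
have [fu [_ /(_ v) [fuv [cuv _]]]] := df u.
have [fv [_ /(_ u) [fvu [cvu _]]]] := df v.
apply: derive_comm; [|exact: cuv|exact: cvu].
apply: filterS (open_near oA Ax) => y Ay.
by split; [exact: fu|exact: fv|exact: fuv|exact: fvu].
Qed.

End Smooth.

(** * Left translations in charts *)

Section LeftTranslations.
Context {R : realType} {m : nat} {G : lieGroupType R m}.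
Implicit Types (a b c p q r : G) (x y : 'rV[R]_m).

Local Notation phi a := (chart_fun (chart_at a)).
Local Notation iphi a := (chart_inv (chart_at a)).
Local Notation Img a := (chart_img (chart_at a)).
Local Notation Dom a := (chart_dom (chart_at a)).

Lemma chart_centerK p : iphi p (phi p p) = p.
Proof. exact/chart_funK/chart_at_dom. Qed.

Lemma chart_center_img p : Img p (phi p p).
Proof. exact/chart_fun_img/chart_at_dom. Qed.

Lemma img_open a : open (Img a : set ('rV[R]_m : normedModType R)).
Proof. exact: chart_img_open. Qed.

Lemma chart_img_near a y : Img a y -> \forall z \near y, Img a z.
Proof. by move=> Iy; apply: open_nbhs_nbhs; split => //; exact: chart_img_open. Qed.

(* Left translation by [q], read in the charts at [a] (source) and [b] (target). *)
Definition ltr q a b y : 'rV[R]_m := phi b (q * iphi a y)%g.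

Definition ltr_dom q a b : set 'rV[R]_m := [set y | Img a y /\ Dom b (q * iphi a y)%g].

Lemma lmul_cts q : continuous (fun z : G => (q * z)%g).
Proof.
move=> z; apply: (@continuous_comp _ _ _ (fun z => (q, z)) (fun xy : G * G => (xy.1 * xy.2)%g)).
  by apply: cvg_pair; [exact: cvg_cst|exact: cvg_id].
exact: lie_mul_cts.
Qed.

Lemma chart_preimage_open a (D : set G) (h : G -> G) : open D -> continuous h ->
  open [set y | Img a y /\ D (h (iphi a y))].
Proof.
move=> oD ch; rewrite openE => y [Iy Dy]; apply: filterI.
  by apply: open_nbhs_nbhs; split => //; exact: chart_img_open.
have ci := chart_inv_cts Iy.
have cc := continuous_comp ci (ch (iphi a y)).
exact: (cc D (open_nbhs_nbhs (conj oD Dy))).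
Qed.

Lemma ltr_dom_open q a b : open (ltr_dom q a b).
Proof. by apply: chart_preimage_open; [exact: chart_dom_open|exact: lmul_cts]. Qed.

(** The multiplication read in charts, with its first argument frozen at the coordinates of [q] in
    the chart at [q]. *)
Lemma ltr_smooth q a b : smooth_on (ltr_dom q a b) (ltr q a b).
Proof.
move=> k.
pose L (y : 'rV[R]_m) : 'rV[R]_m * 'rV[R]_m := (phi q q, y).
have cL : continuous L.
  move=> y; apply: differentiable_continuous.
  by apply: (@differentiable_pair _ _ _ _ (fun=> phi q q) id).
have TL (h : R) v y : L (h *: v + y) = h *: (0, v) + L y.
  by congr pair; rewrite /= ?scaler0 ?add0r.
have := Ck_on_comp_affine (T := fun v => (0, v)) cL TL (lie_mul_smooth q a b k).
rewrite /comp /L /= chart_centerK; apply: Ck_on_sub => y [Iy Dy].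
by split => //=; rewrite ?chart_centerK//; exact: chart_center_img.
Qed.

Lemma ltr_differentiable q a b y : ltr_dom q a b y -> differentiable (ltr q a b) y.
Proof.
by move=> dy; exact: (C1_on_differentiable_row (@ltr_dom_open q a b) (@ltr_smooth q a b 1) dy).
Qed.

(* locked, so that [mxE] does not unfold it *)
Definition dltr q a b y : 'M[R]_m := locked ('J (ltr q a b) y).

Lemma derive_ltr q a b y v : ltr_dom q a b y -> 'D_v (ltr q a b) y = v *m dltr q a b y.
Proof. by move=> /ltr_differentiable d; rewrite /dltr -lock deriveEjacobian. Qed.

Lemma ltr_comp r q a b c y : ltr_dom q a b y -> ltr r b c (ltr q a b y) = ltr (r * q)%g a c y.
Proof. by move=> [Iy Dy]; rewrite /ltr chart_funK// mulgA. Qed.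

Lemma ltr_dom_comp r q a b c y : ltr_dom q a b y -> ltr_dom (r * q)%g a c y ->
  ltr_dom r b c (ltr q a b y).
Proof.
move=> [Iy Dy] [_ Dc]; split; first exact: chart_fun_img.
by rewrite /ltr chart_funK// mulgA.
Qed.

(** The chain rule, with [g] known to be the composite only near [y]: identities between maps read
    in charts hold only on open sets. *)
Lemma derive_ltr_comp {W : normedModType R} (f g : 'rV[R]_m -> W) q a b y v :
  ltr_dom q a b y -> differentiable f (ltr q a b y) ->
  (\forall z \near y, f (ltr q a b z) = g z) ->
  'D_v g y = 'D_(v *m dltr q a b y) f (ltr q a b y).
Proof.
move=> dy df fg; have dl := ltr_differentiable dy.
rewrite -(@near_eq_derive _ _ _ (f \o ltr q a b) g y v fg).
have dc := differentiable_comp dl df.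
rewrite (@deriveE _ _ _ (f \o ltr q a b) y v dc).
rewrite (@deriveE _ _ _ f _ (v *m _) df).
apply: (etrans (congr1 (fun h : 'rV[R]_m -> W => h v) (diff_comp dl df))).
by congr ('d f _ _); rewrite /dltr -lock /jacobian mul_rV_lin1.
Qed.

Lemma dltr_comp r q a b c y : ltr_dom q a b y -> ltr_dom (r * q)%g a c y ->
  dltr (r * q)%g a c y = dltr q a b y *m dltr r b c (ltr q a b y).
Proof.
move=> dy dcy; have db := ltr_dom_comp dy dcy.
apply/row_matrixP => i; rewrite !rowE mulmxA.
apply: (etrans (esym (derive_ltr _ dcy))); apply: (etrans _ (derive_ltr _ db)).
apply: (@derive_ltr_comp _ (ltr r b c) (ltr (r * q)%g a c) q a b y _ dy (ltr_differentiable db)).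
by apply: filterS (open_near (@ltr_dom_open q a b) dy) => z /ltr_comp ->.
Qed.

Lemma ltr_id a y : Img a y -> ltr_dom 1%g a a y /\ ltr 1%g a a y = y.
Proof. move=> Iy; rewrite /ltr_dom /ltr /= mul1g chart_invK//; split => //.
by split => //; exact: chart_inv_dom. Qed.

Lemma dltr_id a y : Img a y -> dltr 1%g a a y = 1%:M.
Proof.
move=> Iy; have [dy _] := ltr_id Iy.
apply/row_matrixP => i; rewrite !rowE mulmx1.
apply: (etrans (esym (derive_ltr _ dy))); apply: (etrans _ (derive_id y _)).
apply: near_eq_derive.
by apply: filterS (chart_img_near Iy) => z /ltr_id[].
Qed.

Lemma dltrK q a b y : ltr_dom q a b y ->
  dltr q a b y *m dltr (q^-1)%g b a (ltr q a b y) = 1%:M.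
Proof.
move=> dy; have [d1 _] := ltr_id dy.1.
by rewrite -dltr_comp// mulVg// dltr_id//; exact: dy.1.
Qed.

Lemma dltr_unit q a b y : ltr_dom q a b y -> dltr q a b y \in unitmx.
Proof.
move=> dy; have E := dltrK dy.
have U := @mulmx1_unit R m _ _ E.
exact: U.1.
Qed.

Definition coord1 : 'rV[R]_m := phi (1%g : G) 1%g.

(* The rows are the left-invariant fields extending the standard basis of the
   tangent space at 1, in the chart at [p]. *)
Definition frame p x : 'M[R]_m := dltr (iphi p x) 1%g p coord1.

Lemma ltr_dom_frame p x : Img p x -> ltr_dom (iphi p x) 1%g p coord1.
Proof.
move=> Ix; split; first exact: chart_center_img.
by rewrite chart_centerK mulg1; exact: chart_inv_dom.
Qed.

Lemma ltr_coord1 q a : ltr q 1%g a coord1 = phi a q.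
Proof. by rewrite /ltr chart_centerK mulg1. Qed.

Lemma frame_unit p x : Img p x -> frame p x \in unitmx.
Proof. by move=> /ltr_dom_frame/dltr_unit. Qed.

(** Left-invariance of the frame: the chain rule for the translation by [iphi a y] followed by the
    translation by [q]. *)
Lemma frame_ltr q a b y : ltr_dom q a b y ->
  frame b (ltr q a b y) = frame a y *m dltr q a b y.
Proof.
move=> dy; rewrite /frame {1}/ltr chart_funK; last exact: dy.2.
have d1 := ltr_dom_frame dy.1.
have d2 : ltr_dom (q * iphi a y)%g 1%g b coord1.
  by split; [exact: chart_center_img|rewrite chart_centerK mulg1; exact: dy.2].
rewrite (dltr_comp d1 d2) ltr_coord1 chart_invK; first by [].
exact: dy.1.
Qed.

Lemma frame_coord1 : frame 1%g coord1 = 1%:M.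
Proof. by rewrite /frame chart_centerK (dltr_id (chart_center_img 1%g)). Qed.

(** Row [i] is the derivative of the multiplication along [(0, delta_mx 0 i)], with the second
    argument frozen at [coord1]; this costs one order of smoothness, whence [k.+1]. *)
Lemma frame_smooth k p i j : Ck_on k (Img p) (fun x => frame p x i j : R^o).
Proof.
pose L (x : 'rV[R]_m) : 'rV[R]_m * 'rV[R]_m := (x, coord1).
have cL : continuous L.
  move=> y; apply: differentiable_continuous.
  by apply: (@differentiable_pair _ _ _ _ id (fun=> coord1)).
have TL (h : R) v y : L (h *: v + y) = h *: (v, 0) + L y.
  by congr pair; rewrite /= ?scaler0 ?add0r.
have [_ /(_ (0, delta_mx 0 i)) [_ H]] := lie_mul_smooth p (1%g : G) p k.+1.
have H1 := Ck_on_comp_affine (T := fun v => (v, 0)) cL TL H.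
have H2 : Ck_on k (Img p) (fun x => 'D_(delta_mx 0 i) (ltr (iphi p x) 1%g p) coord1).
  have := Ck_on_sub _ H1; move=> /(_ (Img p)) H2.
  apply: (@Ck_on_ext _ _ _ k _ _ _ (@img_open p) _ (H2 _)).
    move=> x Ix; rewrite /comp /L /derive.
    apply: (congr1 (fun F : R -> 'rV[R]_m => lim (F h @[h --> 0^']))).
    apply/funext => h /=.
    by rewrite /ltr scaler0 add0r.
  move=> x Ix /=; split => //=; first exact: chart_center_img.
  by rewrite chart_centerK mulg1; exact: chart_inv_dom.
apply: (@Ck_on_ext _ _ R^o k _ _ _ (@img_open p) _ (Ck_on_coord 0 j (@img_open p) H2)).
move=> x Ix /=; rewrite derive_ltr; last exact: ltr_dom_frame.
by rewrite -rowE mxE.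
Qed.

End LeftTranslations.

(** * Matrix algebra *)

(** Since [X - A] divides [X^k - A^k = X^k], the characteristic polynomial divides a power of [X].
    Being monic it is itself a power of [X], and its subleading coefficient, which is minus the
    trace, vanishes. *)
Lemma mxtrace_nilpotent (F : fieldType) n (A : 'M[F]_n) k :
  iter k (mulmx^~ A) 1%:M = 0 -> \tr A = 0.
Proof.
case: n A => [A _|n A Ak]; first by rewrite [A]flatmx0 mxtrace0.
have {}Ak : A ^+ k = 0.
  by rewrite -Ak; elim: k {Ak} => [|k IH]; rewrite ?expr0// exprSr iterS IH.
have dv : char_poly A %| 'X^(k * n.+1).
  pose B := map_mx polyC A; pose Xm : 'M[{poly F}]_n.+1 := scalar_mx 'X.
  have BX : GRing.comm Xm B by rewrite /GRing.comm -!mulmxE mul_scalar_mx mul_mx_scalar.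
  have : \det (Xm ^+ k - B ^+ k) = 'X^(k * n.+1).
    have BE j : B ^+ j = map_mx polyC (A ^+ j).
      by elim: j => [|j IH]; rewrite ?expr0 ?map_mx1// !exprS IH -!mulmxE map_mxM.
    have XE j : Xm ^+ j = scalar_mx ('X ^+ j).
      by elim: j => [|j IH]; rewrite ?expr0// !exprS IH -!mulmxE -scalar_mxM.
    rewrite BE Ak map_mx0 subr0 XE.
    by rewrite det_scalar -exprM.
  rewrite (subrXX_comm k BX) det_mulmx => <-.
  exact: dvdp_mulr.
have {dv} E : char_poly A %= 'X^(n.+1).
  have := dv; rewrite -(subr0 'X) -polyC0 => /dvdp_exp_XsubCP [j jk jE].
  have := eqp_size jE; rewrite size_exp_XsubC size_char_poly => -[jn].
  by rewrite -jn in jE; rewrite jE.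
have {}E : char_poly A = 'X^(n.+1).
  apply/eqP; rewrite -eqp_monic ?char_poly_monic ?monicXn//.
have T := char_poly_trace A isT.
have C : (char_poly A)`_n = 0 by rewrite E coefXn ltn_eqF.
by apply/eqP; rewrite -oppr_eq0 -T /= C.
Qed.

(* Here [gm] is the matrix of the metric at a point, [gi] its inverse and [Gd l] its
   [l]-th partial derivative, [E l] is [J^-1 * d_l J] for the matrix [J] of the
   left-invariant frame, and [d], [dd] are the first and second partial derivatives
   of a homomorphism to the reals. *)
Section LaplacianAlgebra.
Context {F : numFieldType} {m : nat}.
Variables (gm gi : 'M[F]_m) (E Gd : 'I_m -> 'M[F]_m) (d : 'I_m -> F) (dd : 'I_m -> 'I_m -> F).
Hypotheses (gK : gm *m gi = 1%:M) (gis : gi^T = gi).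
Hypothesis GdE : forall l, Gd l = - (E l *m gm) - (E l *m gm)^T.
Hypothesis ddE : forall i j, dd i j = - \sum_k E i j k * d k.
Hypothesis unimodular : forall l, \sum_i E i l i = \tr (E l).

(** After tracing with [gi], the Christoffel terms are of three kinds. Two have the same trace
    [\tr (E l)] and enter with opposite signs; the third reproduces the trace of [dd] given by
    [ddE]. *)
Lemma trace_hessian0 :
  \sum_i \sum_j gi i j * (dd i j -
    \sum_k (2^-1 * \sum_l gi k l * (Gd i j l + Gd j i l - Gd l i j)) * d k) = 0.
Proof.
pose H i := E i *m gm.
have HK i : H i *m gi = E i by rewrite -mulmxA gK mulmx1.
have gs i j : gi i j = gi j i by rewrite -[in LHS]gis mxE.
(* [S] is the trace of a bilinear form with respect to the metric. *)
pose S (f : 'I_m -> 'I_m -> F) := \sum_i \sum_j gi i j * f i j.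
have SD f f' : S (fun i j => f i j + f' i j) = S f + S f'.
  rewrite -big_split; apply: eq_bigr => i _; rewrite -big_split; apply: eq_bigr => j _.
  by rewrite mulrDr.
have SN f : S (fun i j => - f i j) = - S f.
  rewrite -sumrN; apply: eq_bigr => i _; rewrite -sumrN; apply: eq_bigr => j _.
  by rewrite mulrN.
have SC f : S (fun i j => f j i) = S f.
  rewrite /S exchange_big; apply: eq_bigr => i _; apply: eq_bigr => j _.
  by rewrite gs.
have SZ f (a : F) : S (fun i j => f i j * a) = S f * a.
  rewrite /S mulr_suml; apply: eq_bigr => i _; rewrite mulr_suml.
  by apply: eq_bigr => j _; rewrite mulrA.
have SS (f : 'I_m -> 'I_m -> 'I_m -> F) : S (fun i j => \sum_k f k i j) = \sum_k S (f k).
  rewrite exchange_big; apply: eq_bigr => i _.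
  rewrite exchange_big; apply: eq_bigr => j _.
  by rewrite mulr_sumr.
(* Unimodularity enters here, and makes this trace equal to the one in [T]. *)
have B l : S (fun i j => H i l j) = \tr (E l).
  rewrite -unimodular; apply: eq_bigr => i _; rewrite -[in RHS]HK mxE.
  by apply: eq_bigr => j _; rewrite mulrC gs.
have T l : S (fun i j => H l i j) = \tr (E l).
  apply: eq_bigr => i _; rewrite -[in RHS]HK mxE.
  by apply: eq_bigr => j _; rewrite mulrC gs.
have C l : S (fun i j => Gd i j l + Gd j i l - Gd l i j) = - (S (fun i j => H i j l) *+ 2).
  have GE a i j : Gd a i j = - H a i j - H a j i.
    by rewrite GdE -/(H a); move: (H a) => h; rewrite !mxE.
  rewrite (_ : S _ = S (fun i j => - H i j l - H i l j + (- H j i l - H j l i) -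
      (- H l i j - H l j i))); last first.
    by apply: eq_bigr => i _; apply: eq_bigr => j _; rewrite !GE.
  rewrite !(SD, SN) (SC (fun i j => H i j l)) (SC (fun i j => H i l j)).
  rewrite (SC (fun i j => H l i j)).
  rewrite B T mulr2n; ring.
rewrite -[LHS]/(S (fun i j => dd i j -
  \sum_k (2^-1 * \sum_l gi k l * (Gd i j l + Gd j i l - Gd l i j)) * d k)).
rewrite SD SN SS.
rewrite (_ : S dd = - \sum_k S (fun i j => E i j k) * d k); last first.
  rewrite (_ : S dd = S (fun i j => - \sum_k E i j k * d k)).
    by rewrite SN SS; congr (- _); apply: eq_bigr => k _; rewrite SZ.
  by apply: eq_bigr => i _; apply: eq_bigr => j _; rewrite ddE.
apply/eqP; rewrite subr_eq0 eq_sym -subr_eq0 opprK -big_split /=; apply/eqP.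
apply: big1 => k _; rewrite SZ -mulrDl.
rewrite (_ : S _ = 2^-1 *
    \sum_l gi k l * S (fun i j => Gd i j l + Gd j i l - Gd l i j)); last first.
  rewrite mulr_sumr; under [RHS]eq_bigr do rewrite mulrA mulrC -SZ.
  rewrite -SS; apply: eq_bigr => i _; apply: eq_bigr => j _; congr (_ * _).
  by rewrite mulr_sumr; apply: eq_bigr => l _; ring.
under eq_bigr do rewrite C mulrN mulrnAr.
rewrite sumrN sumrMnl mulrN -[X in 2^-1 * X]mulr_natl mulKf ?pnatr_eq0//.
rewrite (_ : \sum_l _ = S (fun i j => E i j k)) ?addNr ?mul0r//.
under eq_bigr do rewrite mulrC -SZ.
rewrite -SS; apply: eq_bigr => i _; apply: eq_bigr => j _; congr (_ * _).
by rewrite -[in RHS]HK mxE; apply: eq_bigr => l _; rewrite gs.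
Qed.
End LaplacianAlgebra.

(** The hypotheses make [N] an invertible idempotent. *)
Lemma gram_projection (F : comUnitRingType) n (N : 'M[F]_n) :
  N \in unitmx -> N^T = N -> N *m N^T = N -> N = 1%:M.
Proof. by move=> uN -> E; rewrite -(mulmxK uN N) E mulmxV. Qed.

Lemma posdef_unit (F : numFieldType) n (g : 'M[F]_n) :
  (forall u : 'rV_n, u != 0 -> 0 < (u *m g *m u^T) 0 0) -> g \in unitmx.
Proof.
move=> H; rewrite -row_free_unit -kermx_eq0; apply: contraT => /rowV0Pn[u].
move=> /sub_kermxP ug /H; rewrite ug mul0mx mxE ltxx //.
Qed.

Lemma delta_form (F : nzRingType) m n (A : 'M[F]_(m, n)) i j :
  ((delta_mx 0 i : 'rV_m) *m A *m (delta_mx 0 j : 'rV_n)^T) 0 0 = A i j.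
Proof. by rewrite -rowE trmx_delta -colE !mxE. Qed.

(** * Brackets of left-invariant fields *)

Section MatrixDerivative.
Context {R : realType} {m : nat}.

Lemma derive_basis {W : normedModType R} (f : 'rV[R]_m -> W) x v : differentiable f x ->
  'D_v f x = \sum_l v 0 l *: 'D_(delta_mx 0 l) f x.
Proof.
move=> df; rewrite (deriveE _ df) {1}(row_sum_delta v) linear_sum /=.
by apply: eq_bigr => l _; rewrite linearZ /= (deriveE _ df).
Qed.

Definition mxpartial {n p} (l : 'I_m) (A : 'rV[R]_m -> 'M[R]_(n, p)) x : 'M[R]_(n, p) :=
  \matrix_(i, j) 'D_(delta_mx 0 l) (fun y => A y i j : R^o) x.

Lemma mxpartialE n p l (A : 'rV[R]_m -> 'M[R]_(n, p)) x i j :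
  mxpartial l A x i j = 'D_(delta_mx 0 l) (fun y => A y i j : R^o) x.
Proof. by rewrite mxE. Qed.

Lemma near_eq_mxpartial n p l (A B : 'rV[R]_m -> 'M[R]_(n, p)) x :
  (\forall y \near x, A y = B y) -> mxpartial l A x = mxpartial l B x.
Proof.
move=> AB; apply/matrixP => i j; rewrite !mxE; apply: near_eq_derive.
by apply: filterS AB => y ->.
Qed.

Lemma mxpartial_cst n p l (C : 'M[R]_(n, p)) x : mxpartial l (fun=> C) x = 0.
Proof. by apply/matrixP => i j; rewrite !mxE; exact: derive_cst. Qed.

Lemma mxpartial_tr n p l (A : 'rV[R]_m -> 'M[R]_(n, p)) x :
  mxpartial l (fun y => (A y)^T) x = (mxpartial l A x)^T.
Proof. by apply/matrixP => i j; rewrite !mxE; under eq_fun do rewrite mxE. Qed.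

Definition mxderivable {n p} (l : 'I_m) (A : 'rV[R]_m -> 'M[R]_(n, p)) x :=
  forall i j, derivable (fun y => A y i j : R^o) x (delta_mx 0 l).

Lemma mulmx_entry n p q (A : 'rV[R]_m -> 'M[R]_(n, p)) (B : 'rV[R]_m -> 'M[R]_(p, q)) i j :
  (fun y => (A y *m B y) i j : R^o) =
  \sum_k ((fun y => A y i k : R^o) * (fun y => B y k j : R^o)).
Proof. by apply/funext => y; rewrite fct_sumE mxE. Qed.

Lemma mxderivableM n p q l (A : 'rV[R]_m -> 'M[R]_(n, p)) (B : 'rV[R]_m -> 'M[R]_(p, q)) x :
  mxderivable l A x -> mxderivable l B x -> mxderivable l (fun y => A y *m B y) x.
Proof.
move=> dA dB i j; rewrite mulmx_entry.
by apply: derivable_sum => k; apply: derivableM; [exact: dA|exact: dB].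
Qed.

Lemma mxpartialM n p q l (A : 'rV[R]_m -> 'M[R]_(n, p)) (B : 'rV[R]_m -> 'M[R]_(p, q)) x :
  mxderivable l A x -> mxderivable l B x ->
  mxpartial l (fun y => A y *m B y) x =
  mxpartial l A x *m B x + A x *m mxpartial l B x.
Proof.
move=> dA dB; apply/matrixP => i j; rewrite !mxE mulmx_entry derive_sum; last first.
  by move=> k; apply: derivableM; [exact: dA|exact: dB].
rewrite -big_split; apply: eq_bigr => k _.
rewrite (deriveM (dA i k) (dB k j)) !mxE addrC; congr (_ + _).
exact: mulrC.
Qed.

End MatrixDerivative.

Section Bracket.
Context {R : realType} {m : nat} {G : lieGroupType R m}.
Implicit Types (a b c p q r : G) (x y : 'rV[R]_m).

Local Notation phi a := (chart_fun (chart_at a)).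
Local Notation iphi a := (chart_inv (chart_at a)).
Local Notation Img a := (chart_img (chart_at a)).
Local Notation Dom a := (chart_dom (chart_at a)).
Local Notation coord1 := (@coord1 R m G).

Lemma frame_mxderivable p x l : Img p x -> mxderivable l (frame p) x.
Proof.
move=> Ix i j; have [_ df] := frame_smooth 1 p i j.
by have [d _] := df (delta_mx 0 l); exact: d.
Qed.

Lemma frame_row_differentiable p x (v : 'rV[R]_m) : Img p x ->
  differentiable (fun z => v *m frame p z) x.
Proof.
move=> Ix; apply: differentiable_rowP => j.
have H : Ck_on 1 (Img p) (fun z => (v *m frame p z) 0 j : R^o).
  apply: (@Ck_on_mulmx _ _ 1 (Img p) _ _ _ (fun=> v) (frame p) (@img_open _ _ _ p)).
    by move=> a b; exact: Ck_on_cst.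
  by move=> a b; exact: frame_smooth.
exact: (C1_on_differentiable (@img_open _ _ _ p) H Ix).
Qed.

Lemma derive_row_frame p x (u v : 'rV[R]_m) : Img p x ->
  'D_u (fun z => v *m frame p z) x = \sum_l u 0 l *: (v *m mxpartial l (frame p) x).
Proof.
move=> Ix; have df := frame_row_differentiable v Ix.
rewrite (derive_basis _ df); apply: eq_bigr => l _; congr (_ *: _).
rewrite (derive_mx (@diff_derivable _ _ _ _ _ _ df)).
have vc : mxderivable l (fun=> v) x by move=> i j; exact: derivable_cst.
have := mxpartialM vc (@frame_mxderivable p x l Ix).
by rewrite mxpartial_cst mul0mx add0r.
Qed.

Lemma tangent_map_lmul q p (v : 'rV[R]_m) :
  tangent_map (fun y : G => (q * y)%g) p v = v *m dltr q p (q * p)%g (phi p p).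
Proof.
rewrite -derive_ltr//; split; first exact: chart_center_img.
by rewrite chart_centerK; exact: chart_at_dom.
Qed.

Lemma left_fieldE (u : 'rV[R]_m) q : left_field u q = u *m dltr q 1%g q coord1.
Proof. by rewrite /left_field tangent_map_lmul mulg1. Qed.

(** A left-invariant field is given at each point by components in the chart centred there; applied
    to the coordinates of one fixed chart, it is expressed through the rows of [frame p]. *)
Lemma vf_apply_left_field (u : 'rV[R]_m) p x : Img p x ->
  vf_apply (left_field u) (phi p) (iphi p x) = u *m frame p x.
Proof.
move=> Ix; rewrite /vf_apply /dfun left_fieldE.
set q := iphi p x.
have E : phi p \o iphi q = ltr 1%g q p by apply/funext => z; rewrite /ltr /= mul1g.
have d1 : ltr_dom q 1%g q coord1.
  by split; [exact: chart_center_img|rewrite chart_centerK mulg1; exact: chart_at_dom].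
have d2 : ltr_dom (1 * q)%g 1%g p coord1 by rewrite mul1g; exact: ltr_dom_frame.
have d3 := ltr_dom_comp d1 d2.
have C := dltr_comp d1 d2.
rewrite ltr_coord1 in d3 C.
rewrite E (derive_ltr _ d3) -mulmxA /frame -/q.
rewrite mul1g in C.
by rewrite C.
Qed.

Lemma lie_bracketE (u v : 'rV[R]_m) : lie_bracket G u v =
  \sum_l u 0 l *: (v *m mxpartial l (frame (1%g : G)) coord1) -
  \sum_l v 0 l *: (u *m mxpartial l (frame (1%g : G)) coord1).
Proof.
have I1 := @chart_center_img _ _ G 1%g.
have key (a b : 'rV[R]_m) : vf_apply (left_field a)
    (vf_apply (left_field b) (phi (1%g : G))) 1%g =
    \sum_l a 0 l *: (b *m mxpartial l (frame (1%g : G)) coord1).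
  rewrite -derive_row_frame//.
  rewrite {1}/vf_apply /dfun left_fieldE (dltr_id I1) mulmx1.
  apply: near_eq_derive; apply: filterS (chart_img_near I1) => z Iz.
  exact: vf_apply_left_field.
by rewrite /lie_bracket /vf_bracket !key.
Qed.

(** Row [c] holds the components, in the chart at [p], of the bracket of the [a]-th and [c]-th
    left-invariant fields. At 1 this is the matrix of ad, acting on row vectors. *)
Definition frame_ad p x (a : 'I_m) : 'M[R]_m :=
  \sum_l frame p x a l *: mxpartial l (frame p) x -
  frame p x *m (\matrix_(l, k) mxpartial l (frame p) x a k).

Lemma lie_bracket_frame_ad (a : 'I_m) (v : 'rV[R]_m) :
  lie_bracket G (delta_mx 0 a) v = v *m frame_ad (1%g : G) coord1 a.
Proof.
rewrite lie_bracketE /frame_ad frame_coord1 mul1mx mulmxBr mulmx_sumr; congr (_ - _).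
  by apply: eq_bigr => l _; rewrite -scalemxAr !mxE eqxx /= eq_sym.
apply/rowP => k; rewrite summxE mxE; apply: eq_bigr => l _.
by rewrite mxE -rowE [row _ _ _ _]mxE [X in _ = _ * X]mxE.
Qed.

End Bracket.

(** * Unimodularity of nilpotent Lie groups *)

(* In the chart at [p], the second derivatives [H] of the left translation from 1
   to [p] do not contribute to brackets of left-invariant fields. *)
Lemma bracket_transform {F : comNzRingType} {m}
    (J : 'M[F]_m) (D D' H : 'I_m -> 'M[F]_m) (a : 'I_m) :
  (forall i, \sum_l J i l *: D' l = D i *m J + H i) ->
  (forall i c k, H i c k = H c i k) ->
  \sum_l J a l *: D' l - J *m (\matrix_(l, k) D' l a k) =
  (\sum_l (1%:M : 'M[F]_m) a l *: D l - 1%:M *m (\matrix_(l, k) D l a k)) *m J.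
Proof.
move=> E Hs; rewrite mul1mx mulmxBl.
have -> : \sum_l (1%:M : 'M[F]_m) a l *: D l = D a.
  rewrite (bigD1 a)//= mxE eqxx scale1r big1 ?addr0// => l la.
  by rewrite mxE eq_sym (negbTE la) scale0r.
rewrite E -addrA; congr (_ + _).
apply/matrixP => c k.
have /matrixP/(_ a k) := E c; rewrite summxE [RHS]mxE -Hs => Ec.
rewrite [LHS]mxE [X in _ + X]mxE [RHS]mxE.
have -> : (J *m \matrix_(l, k0) D' l a k0) c k = \sum_l (J c l *: D' l) a k.
  by rewrite mxE; apply: eq_bigr => l _; rewrite !mxE.
have -> : (\matrix_(l, k0) D l a k0 *m J) c k = (D c *m J) a k.
  by rewrite !mxE; apply: eq_bigr => l _; rewrite mxE.
by rewrite Ec opprD addrCA subrr addr0.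
Qed.

Section Unimodular.
Context {R : realType} {m : nat} {G : lieGroupType R m}.
Implicit Types (p q : G) (x y : 'rV[R]_m) (a : 'I_m).

Local Notation phi a := (chart_fun (chart_at a)).
Local Notation iphi a := (chart_inv (chart_at a)).
Local Notation Img a := (chart_img (chart_at a)).
Local Notation coord1 := (@coord1 R m G).

Lemma ltr_dom_center p : ltr_dom p 1%g p coord1.
Proof.
by split; [exact: chart_center_img|rewrite chart_centerK mulg1; exact: chart_at_dom].
Qed.

Lemma frame_center p : frame p (phi p p) = dltr p 1%g p coord1.
Proof. by rewrite /frame chart_centerK. Qed.

Lemma ltr_coord_Ck k p q r j :
  Ck_on k (ltr_dom p q r) (fun z => ltr p q r z 0 j : R^o).
Proof. by apply: Ck_on_coord; [exact: ltr_dom_open|exact: ltr_smooth]. Qed.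

Lemma dltr_entry p q r y i j : ltr_dom p q r y ->
  dltr p q r y i j = 'D_(delta_mx 0 i) (fun z => ltr p q r z 0 j : R^o) y.
Proof.
move=> dy; have dl := ltr_differentiable dy.
have := derive_mx (@diff_derivable _ _ _ _ _ (delta_mx 0 i) dl).
rewrite (derive_ltr _ dy) -rowE => /rowP /(_ j).
by rewrite [LHS]mxE [RHS]mxE.
Qed.

Lemma mxpartial_dltr p q r y i c k : ltr_dom p q r y ->
  derivable (fun z => dltr p q r z c k : R^o) y (delta_mx 0 i) /\
  mxpartial i (dltr p q r) y c k =
  'D_(delta_mx 0 i) ('D_(delta_mx 0 c) (fun z => ltr p q r z 0 k : R^o) : _ -> R^o) y.
Proof.
move=> dy.
have N : \forall z \near y,
    'D_(delta_mx 0 c) (fun z => ltr p q r z 0 k : R^o) z = dltr p q r z c k.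
  by apply: filterS (open_near (@ltr_dom_open _ _ _ p q r) dy) => z /dltr_entry ->.
have [_ H] := ltr_coord_Ck 2 p q r k.
have [_ [_ H1]] := H (delta_mx 0 c).
have [D _] := H1 (delta_mx 0 i).
split; first exact: (near_eq_derivable N (D y dy)).
by rewrite mxE; apply/esym; exact: near_eq_derive.
Qed.

Lemma mxpartial_dltr_sym p q r y i c k : ltr_dom p q r y ->
  mxpartial i (dltr p q r) y c k = mxpartial c (dltr p q r) y i k.
Proof.
move=> dy; have [_ E1] := mxpartial_dltr i c k dy; have [_ E2] := mxpartial_dltr c i k dy.
apply: (etrans E1); apply: (etrans _ (esym E2)).
apply: (@C2_derive_comm _ _ (ltr_dom p q r));
  [exact: ltr_dom_open|exact: ltr_coord_Ck|exact: dy].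
Qed.

(** Both sides differentiate [frame_ltr] at [coord1]: the left one by the chain rule, the right one
    by the Leibniz rule, the frame at 1 being the identity. *)
Lemma mxpartial_frame_center p i :
  \sum_l dltr p 1%g p coord1 i l *: mxpartial l (frame p) (phi p p) =
  mxpartial i (frame (1%g : G)) coord1 *m dltr p 1%g p coord1 +
  mxpartial i (dltr p 1%g p) coord1.
Proof.
have dy := ltr_dom_center p.
have I1 := @chart_center_img _ _ G 1%g.
have Ip := @chart_center_img _ _ G p.
have E : mxpartial i (fun y => frame p (ltr p 1%g p y)) coord1 =
    \sum_l dltr p 1%g p coord1 i l *: mxpartial l (frame p) (phi p p).
  apply/matrixP => c k; rewrite summxE mxE.
  have df : differentiable (fun z => frame p z c k : R^o) (ltr p 1%g p coord1).
    apply: (C1_on_differentiable (@img_open _ _ _ p) (frame_smooth 1 p c k)).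
    by rewrite ltr_coord1.
  have near_refl : \forall z \near coord1, (fun z => frame p z c k : R^o) (ltr p 1%g p z)
     = frame p (ltr p 1%g p z) c k by apply: filterE.
  rewrite (derive_ltr_comp _ dy df near_refl) (derive_basis _ df).
  apply: eq_bigr => l _; rewrite -rowE ltr_coord1 [RHS]mxE
    [X in _ = _ * X]mxE [X in X *: _]mxE.
  by [].
rewrite -E.
have dd : mxderivable i (dltr p 1%g p) coord1.
  by move=> c k; exact: (mxpartial_dltr i c k dy).1.
have F1 : mxpartial i (fun y => frame p (ltr p 1%g p y)) coord1 =
    mxpartial i (fun y => frame (1%g : G) y *m dltr p 1%g p y) coord1.
  apply: near_eq_mxpartial.
  apply: filterS (open_near (@ltr_dom_open _ _ _ p 1%g p) dy) => y; exact: frame_ltr.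
apply: (etrans F1).
apply: (etrans (mxpartialM (@frame_mxderivable _ _ _ _ _ i I1) dd)).
by rewrite frame_coord1 mul1mx.
Qed.

(** In other words, the structure constants with respect to the left-invariant frame are the same at
    [p] as at 1. *)
Lemma frame_ad_center p a :
  frame_ad p (phi p p) a = frame_ad (1%g : G) coord1 a *m frame p (phi p p).
Proof.
rewrite /frame_ad frame_coord1 frame_center.
apply: (@bracket_transform _ _ _ (fun l => mxpartial l (frame (1%g : G)) coord1)
  (fun l => mxpartial l (frame p) (phi p p)) (fun l => mxpartial l (dltr p 1%g p) coord1)).
  exact: mxpartial_frame_center.
move=> i c k; exact: (mxpartial_dltr_sym i c k (ltr_dom_center p)).
Qed.

Lemma mem_lin_span (A : set 'rV[R]_m) v : A v -> lin_span A v.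
Proof.
by move=> Av; exists 1, (fun=> 1), (fun=> v); split => //; rewrite big_ord1 scale1r.
Qed.

(** Each application of ad goes one step down the lower central series, so a power of its matrix is
    zero. *)
Lemma mxtrace_frame_ad1 a : nilpotent_lie_group G -> \tr (frame_ad (1%g : G) coord1 a) = 0.
Proof.
move=> [k nilk]; set A := frame_ad _ _ _.
apply: (@mxtrace_nilpotent _ _ _ k).
have H j v : lower_central G j (v *m iter j (mulmx^~ A) 1%:M).
  elim: j => [|j IH] //=.
  apply: mem_lin_span; exists (delta_mx 0 a), (v *m iter j (mulmx^~ A) 1%:M).
  by split => //; rewrite lie_bracket_frame_ad mulmxA.
apply/row_matrixP => i; rewrite row0 rowE.
by have := H k (delta_mx 0 i); rewrite nilk.
Qed.

(** The logarithmic derivative of the frame at the centre of the chart, to be used as [E] in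
    [trace_hessian0]. *)
Definition frame_log p l : 'M[R]_m :=
  invmx (frame p (phi p p)) *m mxpartial l (frame p) (phi p p).

(** Multiplied by the invertible [J], the two sides become the two halves of the trace of
    [frame_ad p a *m invmx J]. By [frame_ad_center] this is the trace of ad at 1, which is zero. *)
Lemma frame_log_unimodular p l : nilpotent_lie_group G ->
  \sum_i frame_log p i l i = \tr (frame_log p l).
Proof.
move=> nilG.
have uJ := frame_unit (chart_center_img p).
set J := frame p (phi p p) in uJ *.
pose t := \col_l \tr (frame_log p l); pose b := \col_l \sum_i frame_log p i l i.
suff : J *m b = J *m t.
  move=> /(congr1 (mulmx (invmx J))); rewrite !mulKmx// => /colP/(_ l).
  by rewrite !mxE.
apply/colP => a.
have JE i : J *m frame_log p i = mxpartial i (frame p) (phi p p) by rewrite mulKVmx.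
have := congr1 (fun M => \tr (M *m invmx J)) (frame_ad_center p a).
rewrite -/J /frame_ad -/J mulmxK// mxtrace_frame_ad1// mulmxBl raddfB mulmx_suml.
rewrite raddf_sum /= mxtrace_mulC mulKmx// => /eqP; rewrite subr_eq0 => /eqP T.
transitivity (\tr (\matrix_(l, k) mxpartial l (frame p) (phi p p) a k)).
  rewrite mxE; under eq_bigr do rewrite mxE mulr_sumr.
  rewrite exchange_big; apply: eq_bigr => i _.
  by rewrite [RHS]mxE -JE [RHS]mxE.
rewrite -T mxE; apply: eq_bigr => i _.
by rewrite [t i 0]mxE -scalemxAl mxtraceZ mxtrace_mulC.
Qed.

End Unimodular.

(** * The Laplacian of a homomorphism *)

Section LeftInvariantMetric.
Context {R : realType} {m : nat} {G : lieGroupType R m}.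
Implicit Types (p q : G) (x y : 'rV[R]_m) (a : 'I_m).

Local Notation phi a := (chart_fun (chart_at a)).
Local Notation iphi a := (chart_inv (chart_at a)).
Local Notation Img a := (chart_img (chart_at a)).
Local Notation coord1 := (@coord1 R m G).

Lemma ltr_dom_chart p x : Img p x -> ltr_dom 1%g p (iphi p x) x.
Proof. by move=> Ix; split => //; rewrite mul1g; exact: chart_at_dom. Qed.

Lemma coord_vectorE p x i : Img p x ->
  coord_vector (chart_at p) i x = delta_mx 0 i *m dltr 1%g p (iphi p x) x.
Proof.
move=> Ix; rewrite /coord_vector.
have -> : phi (iphi p x) \o iphi p = ltr 1%g p (iphi p x).
  by apply/funext => z; rewrite /ltr /= mul1g.
exact: (derive_ltr _ (ltr_dom_chart Ix)).
Qed.

Lemma metric_inE (g : G -> 'M[R]_m) p x : Img p x ->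
  metric_in g (chart_at p) x =
  dltr 1%g p (iphi p x) x *m g (iphi p x) *m (dltr 1%g p (iphi p x) x)^T.
Proof.
move=> Ix; set T := dltr _ _ _ _; apply/matrixP => i j.
rewrite mxE /inner (coord_vectorE _ Ix) (coord_vectorE _ Ix) -/T.
rewrite -[RHS]delta_form trmx_mul !mulmxA; by [].
Qed.

Lemma frame_dltr p x : Img p x ->
  frame p x *m dltr 1%g p (iphi p x) x = dltr (iphi p x) 1%g (iphi p x) coord1.
Proof.
move=> Ix; have d1 := ltr_dom_frame Ix.
have d2 : ltr_dom (1 * iphi p x)%g 1%g (iphi p x) coord1.
  by rewrite mul1g; exact: ltr_dom_center.
have C := dltr_comp d1 d2.
rewrite mul1g ltr_coord1 (chart_invK Ix) in C.
exact: esym C.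
Qed.

(** Both sides are the Gram matrix of the left-invariant frame at [iphi p x], computed in the chart
    at [p] and in the chart centred at that point. *)
Lemma frame_metric (g : G -> 'M[R]_m) p x : Img p x ->
  frame p x *m metric_in g (chart_at p) x *m (frame p x)^T =
  dltr (iphi p x) 1%g (iphi p x) coord1 *m g (iphi p x) *m
    (dltr (iphi p x) 1%g (iphi p x) coord1)^T.
Proof.
move=> Ix; rewrite (metric_inE _ Ix); have := frame_dltr Ix.
move: (dltr (iphi p x) _ _ _) (dltr 1%g _ _ _) (frame p x) => K T J <-.
by rewrite trmx_mul !mulmxA.
Qed.

Lemma bilinear_form_eq (A B : 'M[R]_m) :
  (forall u v : 'rV[R]_m, (u *m A *m v^T) 0 0 = (u *m B *m v^T) 0 0) -> A = B.
Proof.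
move=> H; apply/matrixP => i j.
by have := H (delta_mx 0 i) (delta_mx 0 j); rewrite !delta_form.
Qed.

Lemma left_invariant_translate (g : riemannian_metric G) q : left_invariant g ->
  dltr q 1%g q coord1 *m g q *m (dltr q 1%g q coord1)^T = g 1%g.
Proof.
move=> lg; apply: bilinear_form_eq => u v.
have := lg q 1%g u v; rewrite /= !tangent_map_lmul mulg1 /inner => <-.
by rewrite trmx_mul !mulmxA.
Qed.

Lemma metric_pt_unit (g : riemannian_metric G) p : g p \in unitmx.
Proof. by apply: posdef_unit => u u0; exact: metric_pos. Qed.

(** Composed with a left translation, [f] changes by an additive constant, so its derivatives along
    left-invariant fields do not depend on the point. *)
Lemma derive_hom {W : normedModType R} (f : G -> W) p x (u : 'rV[R]_m) :
  (forall x y : G, f (x * y)%g = f x + f y) -> Img p x ->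
  differentiable (f \o iphi p) x -> differentiable (f \o iphi 1%g) coord1 ->
  'D_(u *m frame p x) (f \o iphi p) x = 'D_u (f \o iphi 1%g) coord1.
Proof.
move=> fM Ix df df1.
have d1 := ltr_dom_frame Ix.
have xE : ltr (iphi p x) 1%g p coord1 = x by rewrite ltr_coord1 chart_invK.
have df' : differentiable (f \o iphi p) (ltr (iphi p x) 1%g p coord1) by rewrite xE.
have N : \forall z \near coord1, (f \o iphi p) (ltr (iphi p x) 1%g p z) =
    (fun z => f (iphi p x) + (f \o iphi 1%g) z) z.
  apply: filterS (open_near (@ltr_dom_open _ _ _ (iphi p x) 1%g p) d1) => z [Iz Dz].
  by rewrite /= /ltr chart_funK// fM.
have := derive_ltr_comp u d1 df' N; rewrite xE -/(frame p x) => <-.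
rewrite (@deriveD _ _ _ (cst (f (iphi p x))) (f \o iphi 1%g) coord1).
- by rewrite derive_cst add0r.
- exact: derivable_cst.
- exact: diff_derivable.
Qed.

Section Homomorphisms.
Variable f : G -> R^o.
Hypotheses (sf : smooth_fun f) (fM : forall x y : G, f (x * y)%g = f x + f y).

Definition hom_partial p x : 'cV[R]_m :=
  \col_l 'D_(delta_mx 0 l) (f \o iphi p : _ -> R^o) x.

Lemma smooth_fun_differentiable p x : Img p x -> differentiable (f \o iphi p : _ -> R^o) x.
Proof. by move=> Ix; exact: (C1_on_differentiable (@img_open _ _ _ p) (sf p 1) Ix). Qed.

Lemma frame_hom_partial p x : Img p x ->
  frame p x *m hom_partial p x = hom_partial 1%g coord1.
Proof.
move=> Ix; apply/colP => a.
have df := smooth_fun_differentiable Ix.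
have df1 := smooth_fun_differentiable (@chart_center_img _ _ G 1%g).
have E := derive_hom (delta_mx 0 a) fM Ix df df1.
rewrite [RHS]mxE -E (derive_basis _ df) mxE; apply: eq_bigr => l _.
rewrite -rowE [X in _ * X]mxE [X in X *: _]mxE.
by [].
Qed.

(** Obtained by differentiating the constant [frame p *m hom_partial p] and multiplying by the
    inverse of the frame. *)
Lemma hom_second_partial p i j :
  partial i (partial j (f \o iphi p)) (phi p p) =
  - \sum_k frame_log p i j k * partial k (f \o iphi p) (phi p p).
Proof.
have Ip := chart_center_img p.
have uJ := frame_unit Ip.
have dd : mxderivable i (hom_partial p) (phi p p).
  move=> a b; have [_ H] := sf p 2.
  have [_ [_ H2]] := H (delta_mx 0 a).
  have [D _] := H2 (delta_mx 0 i).
  by under eq_fun do rewrite mxE; exact: (D _ Ip).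
have := mxpartialM (@frame_mxderivable _ _ _ p _ i Ip) dd.
rewrite (@near_eq_mxpartial _ _ _ _ i _ (fun=> hom_partial 1%g coord1)); last first.
  by apply: filterS (chart_img_near Ip) => z; exact: frame_hom_partial.
rewrite mxpartial_cst => /esym/eqP; rewrite addrC addr_eq0 => /eqP.
move=> /(congr1 (mulmx (invmx (frame p (phi p p))))).
rewrite mulKmx// mulmxN mulmxA -/(frame_log p i).
move=> /colP/(_ j); rewrite mxE.
under eq_fun do rewrite mxE.
move=> E; apply: (etrans E); rewrite mxE; congr (- _); rewrite mxE; apply: eq_bigr => k _.
by rewrite [X in _ * X = _]mxE.
Qed.

Lemma laplacian_hom (g : riemannian_metric G) p :
  nilpotent_lie_group G -> left_invariant g -> laplacian g f p = 0.
Proof.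
move=> nilG lg; rewrite /laplacian /hessian /christoffel.
have Ip := chart_center_img p.
have uJ := frame_unit Ip.
set c := chart_at p; set x := chart_fun c p; set J := frame p x in uJ.
pose gm := metric_in g c x.
have gmE y : Img p y -> frame p y *m metric_in g c y *m (frame p y)^T = g 1%g.
  by move=> Iy; rewrite frame_metric// left_invariant_translate.
have gmJ : J *m gm *m J^T = g 1%g by exact: gmE.
have ug : gm \in unitmx.
  have : J *m gm *m J^T \in unitmx by rewrite gmJ metric_pt_unit.
  by rewrite !unitmx_mul => /andP[/andP[]].
have gmT : gm^T = gm.
  by rewrite /gm metric_inE// !trmx_mul trmxK Defs.metric_sym mulmxA.
have dg l : mxderivable l (metric_in g c) x.
  move=> i j; have [_ H] := metric_smooth g p i j 1.
  have [D _] := H (delta_mx 0 l); exact: D.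
have dJ l : mxderivable l (frame p) x by exact: frame_mxderivable.
have dJT l : mxderivable l (fun y => (frame p y)^T) x.
  by move=> i j; under eq_fun do rewrite mxE; exact: dJ.
(* The matrix [J *m gm *m J^T] is constant; differentiate it, then cancel [J] on the left and [J^T]
   on the right. *)
have GdE l : mxpartial l (metric_in g c) x =
    - (frame_log p l *m gm) - (frame_log p l *m gm)^T.
  have := mxpartialM (mxderivableM (dJ l) (dg l)) (dJT l).
  rewrite (@near_eq_mxpartial _ _ _ _ l _ (fun=> g 1%g)); last first.
    by apply: filterS (chart_img_near Ip) => z; exact: gmE.
  rewrite mxpartial_cst mxpartialM// mxpartial_tr -/J -/gm.
  rewrite (_ : mxpartial l (frame p) x = J *m frame_log p l); last by rewrite mulKVmx.
  rewrite trmx_mul -!mulmxA -mulmxDr -mulmxA -mulmxDr !mulmxA -!mulmxDl.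
  move=> /esym/(congr1 (mulmx (invmx J))); rewrite -!mulmxA mulKmx// mulmx0 !mulmxA.
  move=> /(congr1 (mulmx^~ (invmx J^T))); rewrite mulmxK ?unitmx_tr// mul0mx => E.
  rewrite -/(frame_log p l) in E *; rewrite trmx_mul gmT -opprD; apply/eqP.
  by rewrite -addr_eq0 addrA [X in X + _]addrC E.
have T := @trace_hessian0 _ _ gm (invmx gm) (frame_log p)
   (fun l => mxpartial l (metric_in g c) x)
   (fun k => partial k (f \o chart_inv c) x)
   (fun i j => partial i (partial j (f \o chart_inv c)) x).
rewrite -[RHS]T.
- apply: eq_bigr => i _; apply: eq_bigr => j _; congr (_ * (_ - _)).
  apply: eq_bigr => k _; congr (_ * _ * _); apply: eq_bigr => l _.
  by congr (_ * (_ + _ - _)); exact: esym (mxpartialE _ _ _ _ _).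
- exact: mulmxV.
- by rewrite trmx_inv gmT.
- exact: GdE.
- by move=> i j; exact: hom_second_partial.
- by move=> l; exact: frame_log_unimodular.
Qed.
End Homomorphisms.
End LeftInvariantMetric.

(** * Left-invariant extension of an inner product *)

Lemma congruence_inv {F : comUnitRingType} n (J K A B : 'M[F]_n) :
  J \in unitmx -> K \in unitmx ->
  J *m A *m J^T = K *m (invmx K *m B *m (invmx K)^T) *m K^T ->
  invmx J *m B *m (invmx J)^T = A.
Proof.
move=> uJ uK.
rewrite !mulmxA mulmxV// mul1mx -[RHS]mulmxA -trmx_mul mulmxV// trmx1 mulmx1 => <-.
by rewrite !mulmxA mulVmx// mul1mx -[LHS]mulmxA -trmx_mul mulVmx// trmx1 mulmx1.
Qed.

Section Extension.
Context {R : realType} {m : nat} {G : lieGroupType R m}.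
Implicit Types (p q : G) (x y : 'rV[R]_m).

Local Notation phi a := (chart_fun (chart_at a)).
Local Notation iphi a := (chart_inv (chart_at a)).
Local Notation Img a := (chart_img (chart_at a)).
Local Notation coord1 := (@coord1 R m G).
Local Notation K q := (dltr q 1%g q coord1).

Lemma translation_unit q : K q \in unitmx.
Proof. exact: dltr_unit (ltr_dom_center q). Qed.

Lemma translationM q p : K (q * p)%g = K p *m dltr q p (q * p)%g (phi p p).
Proof.
have d1 := ltr_dom_center p; have d2 := ltr_dom_center (q * p)%g.
have d3 : ltr_dom (q * p)%g 1%g (q * p)%g coord1 by [].
by have := dltr_comp d1 d3; rewrite ltr_coord1.
Qed.

Variable g1 : 'M[R]_m.
Hypotheses (g1s : g1^T = g1) (g1p : forall u : 'rV[R]_m, u != 0 -> 0 < (u *m g1 *m u^T) 0 0).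

(** A tangent vector at [q] is brought back to 1 by [invmx (K q)] and measured there with [g1]. *)
Definition left_extension q : 'M[R]_m := invmx (K q) *m g1 *m (invmx (K q))^T.

Lemma left_extension_inner q u v :
  inner left_extension q u v = ((u *m invmx (K q)) *m g1 *m (v *m invmx (K q))^T) 0 0.
Proof. by rewrite /inner /left_extension trmx_mul !mulmxA. Qed.

Lemma left_extension_sym q : (left_extension q)^T = left_extension q.
Proof. by rewrite /left_extension !trmx_mul trmxK g1s mulmxA. Qed.

Lemma left_extension_pos q u : u != 0 -> 0 < inner left_extension q u u.
Proof.
move=> u0; rewrite left_extension_inner; apply: g1p.
apply: contra u0 => /eqP/(congr1 (mulmx^~ (K q))).
by rewrite mulmxKV ?translation_unit// mul0mx => ->.
Qed.

(** The matrix [K q] refers to the chart at the moving point [q], so smoothness is not visible from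
    the definition. In the chart at [p] the metric is the congruence of [g1] by the inverse of the
    smooth matrix [frame p]. *)
Lemma left_extension_smooth p (i j : 'I_m) :
  smooth_on (Img p) (fun x => metric_in left_extension (chart_at p) x i j : R^o).
Proof.
move=> k.
have JV i' j' : Ck_on k (Img p) (fun x => invmx (frame p x) i' j' : R^o).
  apply: Ck_on_invmx => [||x]; [exact: img_open|exact: frame_smooth|exact: frame_unit].
have H : Ck_on k (Img p)
    (fun x => (invmx (frame p x) *m g1 *m (invmx (frame p x))^T) i j : R^o).
  apply: (@Ck_on_mulmx _ _ k (Img p) _ _ _ (fun x => invmx (frame p x) *m g1)
     (fun x => (invmx (frame p x))^T) (@img_open _ _ _ p)).
  - apply: (@Ck_on_mulmx _ _ k (Img p) _ _ _ (fun x => invmx (frame p x))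
      (fun=> g1) (@img_open _ _ _ p)) => // a b; exact: Ck_on_cst.
  - by move=> a b; under eq_fun do rewrite mxE; exact: JV.
apply: (@Ck_on_ext _ _ R^o k _ _ _ (@img_open _ _ _ p) _ H) => x Ix.
have uJ := frame_unit Ix; have uK := translation_unit (iphi p x).
exact: (congr1 (fun A : 'M[R]_m => A i j)
  (congruence_inv uJ uK (frame_metric left_extension Ix))).
Qed.

Definition left_invariant_metric : riemannian_metric G :=
  RiemannianMetric left_extension_sym left_extension_pos left_extension_smooth.

(** By the chain rule [K (q * p)] is [K p *m E], where [E] is the differential at [p] of the
    translation by [q]; hence [E] cancels. *)
Lemma left_invariant_metricP : left_invariant left_invariant_metric.
Proof.
move=> q p u v; rewrite /= !left_extension_inner !tangent_map_lmul translationM.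
have uK := translation_unit p; have := translation_unit (q * p)%g.
rewrite translationM; set E := dltr q p _ _ => uKE.
have uE : E \in unitmx by move: uKE; rewrite unitmx_mul => /andP[].
have C : E *m invmx (K p *m E) = invmx (K p).
  by rewrite -[LHS](mulKmx uK) [X in _ *m X]mulmxA mulmxV// mulmx1.
by rewrite -!(mulmxA _ E) C.
Qed.

End Extension.

(** * Riemannian submersions *)

Section SubmersionForm.
Context {F : realFieldType} {m n : nat} (A : 'M[F]_(m, n)) (A' : 'M[F]_(n, m)).
Hypothesis A'K : A' *m A = 1%:M.

Lemma row_sqr (k : nat) (w : 'rV[F]_k) : (w *m w^T) 0 0 = \sum_j w 0 j ^+ 2.
Proof. by rewrite mxE; apply: eq_bigr => j _; rewrite mxE expr2. Qed.

Lemma row_sqr_ge0 (k : nat) (w : 'rV[F]_k) : 0 <= (w *m w^T) 0 0.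
Proof. by rewrite row_sqr; apply: sumr_ge0 => j _; exact: sqr_ge0. Qed.

Lemma row_sqr_eq0 (k : nat) (w : 'rV[F]_k) : (w *m w^T) 0 0 = 0 -> w = 0.
Proof.
rewrite row_sqr => /eqP; rewrite psumr_eq0; last by move=> j _; exact: sqr_ge0.
move=> /allP H; apply/rowP => j; rewrite mxE.
by have := H j (mem_index_enum j); rewrite /= sqrf_eq0 => /eqP.
Qed.

(** As [A' *m A] is the identity, this is the projection of row vectors onto the kernel of [A] along
    the row space of [A']. *)
Let ker : 'M[F]_m := 1%:M - A *m A'.

Definition submersion_form : 'M[F]_m := A *m A^T + ker *m ker^T.

Let kerA : ker *m A = 0.
Proof. by rewrite mulmxBl mul1mx -mulmxA A'K mulmx1 subrr. Qed.

Let kerK : ker *m ker = ker.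
Proof. by rewrite {2}/ker mulmxBr mulmx1 mulmxA kerA mul0mx subr0. Qed.

Lemma submersion_formE (u v : 'rV[F]_m) : u *m submersion_form *m v^T =
  (u *m A) *m (v *m A)^T + (u *m ker) *m (v *m ker)^T.
Proof. by rewrite /submersion_form mulmxDr mulmxDl !trmx_mul !mulmxA. Qed.

Lemma submersion_form_sym : submersion_form^T = submersion_form.
Proof. by rewrite /submersion_form linearD /= !trmx_mul !trmxK. Qed.

(** A vector killed both by [A] and by the projection onto its kernel is zero. *)
Lemma submersion_form_pos (u : 'rV[F]_m) : u != 0 -> 0 < (u *m submersion_form *m u^T) 0 0.
Proof.
move=> u0; rewrite submersion_formE mxE lt_neqAle addr_ge0 ?row_sqr_ge0// andbT eq_sym.
rewrite paddr_eq0 ?row_sqr_ge0//; apply: contra u0.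
move=> /andP[/eqP/row_sqr_eq0 uA /eqP/row_sqr_eq0 uK].
by apply/eqP; move: uK; rewrite mulmxBr mulmx1 mulmxA uA mul0mx subr0.
Qed.

(** Horizontality tested on [w = u *m ker], which lies in the kernel of [A], says that [u *m ker]
    has square norm zero; so only the first summand of the form remains. *)
Lemma submersion_form_horizontal (u v : 'rV[F]_m) :
  (forall w : 'rV[F]_m, w *m A = 0 -> (u *m submersion_form *m w^T) 0 0 = 0) ->
  (u *m submersion_form *m v^T) 0 0 = ((u *m A) *m (v *m A)^T) 0 0.
Proof.
move=> hu; have : u *m ker = 0.
  have kA : (u *m ker) *m A = 0 by rewrite -mulmxA kerA mulmx0.
  apply: row_sqr_eq0; have := hu _ kA.
  by rewrite submersion_formE kA trmx0 mulmx0 add0r -[u *m ker *m ker]mulmxA kerK.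
by rewrite submersion_formE => ->; rewrite mul0mx addr0.
Qed.

End SubmersionForm.

(* [B] is the differential of a Riemannian submersion. The rows of [B^T g^-1] are
   horizontal; their Gram matrix for [g] is [N := B^T g^-1 B] and that of their
   images is [N N^T], so [N N^T = N], with [N] invertible. *)
Lemma submersion_gram {F : realFieldType} {m n}
    (g : 'M[F]_m) (B : 'M[F]_(m, n)) (B' : 'M[F]_(n, m)) :
  g^T = g -> (forall u : 'rV_m, u != 0 -> 0 < (u *m g *m u^T) 0 0) -> B' *m B = 1%:M ->
  (forall u v : 'rV_m,
     (forall w : 'rV_m, w *m B = 0 -> (u *m g *m w^T) 0 0 = 0) ->
     (forall w : 'rV_m, w *m B = 0 -> (v *m g *m w^T) 0 0 = 0) ->
     ((u *m B) *m (v *m B)^T) 0 0 = (u *m g *m v^T) 0 0) ->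
  B^T *m invmx g *m B = 1%:M.
Proof.
move=> gs gp BK H; set N := B^T *m _ *m _.
have ug := posdef_unit gp.
have gis : (invmx g)^T = invmx g by rewrite trmx_inv gs.
have Ns : N^T = N by rewrite /N !trmx_mul trmxK gis mulmxA.
pose lft (y : 'rV[F]_n) := y *m B^T *m invmx g.
have lftg y : lft y *m g = y *m B^T by rewrite mulmxKV.
have lftB y : lft y *m B = y *m N by rewrite /lft /N !mulmxA.
have hor y (w : 'rV_m) : w *m B = 0 -> (lft y *m g *m w^T) 0 0 = 0.
  by move=> wB; rewrite lftg -mulmxA -trmx_mul wB trmx0 mulmx0 mxE.
have pair y z : lft y *m g *m (lft z)^T = y *m N *m z^T.
  by rewrite lftg /lft !trmx_mul trmxK gis !mulmxA.
have NN : N *m N^T = N.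
  apply/matrixP => i j.
  have := H _ _ (hor (delta_mx 0 i)) (hor (delta_mx 0 j)).
  have E (M : 'M[F]_n) (y z : 'rV_n) : y *m M *m (M^T *m z^T) = y *m (M *m M^T) *m z^T.
    by rewrite !mulmxA.
  by rewrite pair !lftB trmx_mul E !delta_form.
(* [N] is the Gram matrix of [lft], which is injective because [B' *m B] is the identity; hence [N]
   is positive definite. *)
apply: gram_projection => //; apply: posdef_unit => y y0.
rewrite -pair; apply: gp; apply: contra y0 => /eqP l0.
have : y *m B^T = 0 by rewrite -lftg l0 mul0mx.
by move=> /(congr1 (mulmx^~ B'^T)); rewrite -mulmxA -trmx_mul BK trmx1 mulmx1 mul0mx => ->.
Qed.

Section NaturalEpimorphism.
Context {R : realType} {m n : nat} {G : lieGroupType R m}.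
Implicit Types (p q : G).

Local Notation phi a := (chart_fun (chart_at a)).
Local Notation iphi a := (chart_inv (chart_at a)).
Local Notation coord1 := (@coord1 R m G).
Local Notation K q := (dltr q 1%g q coord1).

Variable Phi : G -> 'rV[R]_n.
Hypotheses (sPhi : smooth_fun Phi) (PhiM : forall x y : G, Phi (x * y)%g = Phi x + Phi y).

Lemma smooth_row_differentiable p x : chart_img (chart_at p) x ->
  differentiable (Phi \o iphi p) x.
Proof.
by move=> Ix; exact: (C1_on_differentiable_row (@img_open _ _ _ p) (sPhi p 1) Ix).
Qed.

Definition hom_jacobian p : 'M[R]_(m, n) := locked ('J (Phi \o iphi p) (phi p p)).

Lemma dfun_hom p u : dfun Phi p u = u *m hom_jacobian p.
Proof.
rewrite /hom_jacobian -lock /dfun deriveEjacobian//.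
exact: smooth_row_differentiable (chart_center_img p).
Qed.

(** The differential of a homomorphism into a vector space is left-invariant. *)
Lemma translation_hom_jacobian p : K p *m hom_jacobian p = hom_jacobian (1%g : G).
Proof.
apply/row_matrixP => i; rewrite !rowE mulmxA -!dfun_hom /dfun -frame_center.
apply: derive_hom => //; first exact: chart_center_img.
  exact: smooth_row_differentiable (chart_center_img p).
exact: smooth_row_differentiable (chart_center_img (1%g : G)).
Qed.

Variable (A' : 'M[R]_(n, m)).
Hypothesis A'K : A' *m hom_jacobian (1%g : G) = 1%:M.
Local Notation A := (hom_jacobian (1%g : G)).

Lemma hom_jacobian_section p : A' *m K p *m hom_jacobian p = 1%:M.
Proof. by rewrite -mulmxA translation_hom_jacobian. Qed.

Lemma hom_jacobianE p : hom_jacobian p = invmx (K p) *m A.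
Proof. by rewrite -(translation_hom_jacobian p) mulKmx// translation_unit. Qed.

Definition natural_metric : riemannian_metric G :=
  left_invariant_metric (@submersion_form_sym _ _ _ A A') (@submersion_form_pos _ _ _ A A').

Lemma natural_metric_submersion : (forall y, exists p, Phi p = y) ->
  riemannian_submersion natural_metric Phi.
Proof.
move=> sur; split => //.
  move=> p y; exists (y *m A' *m K p).
  by rewrite dfun_hom -!mulmxA (mulmxA A') hom_jacobian_section mulmx1.
have hE p u : horizontal natural_metric Phi p u ->
    forall w : 'rV[R]_m, w *m A = 0 ->
    ((u *m invmx (K p)) *m submersion_form A A' *m w^T) 0 0 = 0.
  move=> hu w wA; have := hu (w *m K p).
  rewrite dfun_hom -mulmxA translation_hom_jacobian => /(_ wA).
  by rewrite /= left_extension_inner mulmxK ?translation_unit.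
move=> p u v hu _; rewrite /= left_extension_inner.
rewrite (submersion_form_horizontal A'K) ?dfun_hom; last exact: hE.
by rewrite hom_jacobianE !mulmxA.
Qed.

End NaturalEpimorphism.

(** * Surjectivity *)

(** The solution is a fixed point of [z |-> psi z + y]. With [y] of norm at most [r / 2], and [psi]
    at least halving norms on the closed ball of radius [r], this contraction maps that ball into
    itself. *)
Lemma contraction_onto {R : realType} {X : completeNormedModType R} (psi : X -> X) (r : R) :
  0 < r -> psi 0 = 0 ->
  (forall y z, `|y| <= r -> `|z| <= r -> `|psi y - psi z| <= 2^-1 * `|y - z|) ->
  forall y, `|y| <= r / 2 -> exists2 z, `|z| <= r & z - psi z = y.
Proof.
move=> r0 psi0 lip y yr.
pose U : set X := closed_ball_ (fun x => `|x|) 0 r.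
have UE z : U z = (`|z| <= r) :> Prop by rewrite /U /closed_ball_ /= sub0r normrN.
have hU : set_fun U U (fun z => psi z + y).
  move=> z; rewrite !UE => zr; rewrite (le_trans (ler_normD _ _))//.
  rewrite [leRHS](splitr r) lerD//.
  have := lip z 0 zr; rewrite normr0 psi0 !subr0 => /(_ (ltW r0))/le_trans; apply.
  by rewrite mulrC ler_pM2r.
have ctr : is_contraction (mkfun_fun hU).
  exists (2^-1)%:nng; split => /=; first by rewrite invf_lt1// ltr1n.
  move=> [a b] [/=]; rewrite !UE => ar br.
  have -> : psi a + y - (psi b + y) = psi a - psi b by rewrite opprD addrACA subrr addr0.
  exact: lip.
have [||z Uz zE] := banach_fixed_point ctr.
- exact: closed_closed_ball_.
- by exists 0; rewrite UE normr0 ltW.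
exists z; first by move: Uz; rewrite UE.
by rewrite {1}zE /= addrAC subrr add0r.
Qed.

(** Joins completeness to the normed structure of matrices, so that [contraction_onto] applies to
    row vectors. *)
HB.instance Definition _ (R : realType) (m n : nat) := Complete.on 'M[R]_(m, n).

Section LocalSurjectivity.
Context {R : realType} {n : nat}.

Lemma mulmx_differentiable (k : nat) (M : 'M[R]_(n, k)) (z : 'rV[R]_n) :
  differentiable (fun z : 'rV[R]_n => z *m M) z.
Proof.
apply: differentiable_rowP => j.
rewrite (_ : (fun _ => _) = \sum_i (fun y : 'rV[R]_n => y 0 i * M i j : R^o)); last first.
  by apply/funext => y; rewrite fct_sumE mxE.
apply: differentiable_sum => i; apply: differentiableM => //.
exact: differentiable_coord.
Qed.

(** The map [psi z = z - F z] has zero differential at 0, hence small partial derivatives nearby,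
    and is a contraction on a small ball. *)
Lemma locally_onto (D : set 'rV[R]_n) (F : 'rV[R]_n -> 'rV[R]_n) :
  open (D : set ('rV[R]_n : normedModType R)) -> D 0 -> Ck_on 1 D F -> F 0 = 0 ->
  (forall v, 'D_v F 0 = v) ->
  exists2 r : R, 0 < r & forall y : 'rV[R]_n, `|y| <= r -> exists2 z, D z & F z = y.
Proof.
move=> oD D0 CF F0 DF.
(* Chosen so that [n%:R * e] is at most one half, the contraction constant; the added 1 covers
   [n = 0]. *)
pose e : R := 2^-1 / (n%:R + 1).
have n0 : 0 < n%:R + 1 :> R by rewrite ltr_wpDl.
have e0 : 0 < e by rewrite divr_gt0// invr_gt0.
pose ps (j : 'I_n) : 'rV[R]_n -> R^o := fun z => z 0 j - F z 0 j.
have CFj j : Ck_on 1 D (fun z => F z 0 j : R^o) by apply: Ck_on_coord.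
have dps z i j : D z -> is_derive z (delta_mx 0 i : 'rV_n) (ps j)
    ((delta_mx 0 i : 'rV[R]_n) 0 j - 'D_(delta_mx 0 i) (fun z => F z 0 j : R^o) z).
  move=> Dz; have [_ H] := CFj j; have [d _] := H (delta_mx 0 i).
  apply: is_deriveB; last exact/derivableP/d.
  have dc := @differentiable_coord R 1 n z 0 j.
  split; first exact: diff_derivable.
  have dI := @derivable_id R 'rV[R]_n z (delta_mx 0 i).
  have := derive_mx dI; rewrite derive_id => /rowP/(_ j) ->.
  by rewrite mxE.
have small : \forall z \near (0 : 'rV[R]_n), forall ij : 'I_n * 'I_n,
   `|(delta_mx 0 ij.1 : 'rV[R]_n) 0 ij.2 - 'D_(delta_mx 0 ij.1) (fun z => F z 0 ij.2 : R^o) z| <= e.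
  apply: (@filter_forall _ _ (fun ij z => `|(delta_mx 0 ij.1 : 'rV[R]_n) 0 ij.2 -
     'D_(delta_mx 0 ij.1) (fun z => F z 0 ij.2 : R^o) z| <= e) (nbhs (0 : 'rV[R]_n)) _).
  move=> [i j] /=; have [_ H] := CFj j; have [_ [c _]] := H (delta_mx 0 i).
  have c0 := c 0 D0.
  have E : 'D_(delta_mx 0 i) (fun z => F z 0 j : R^o) 0 = (delta_mx 0 i : 'rV[R]_n) 0 j.
    have [_ HF] := CF; have [d _] := HF (delta_mx 0 i).
    have := derive_mx (d 0 D0); rewrite DF => /rowP/(_ j) ->.
    by rewrite mxE.
  by rewrite -E; move/cvgrPdist_le : c0; apply.
have NN := @filterI _ _ (nbhs_filter (0 : 'rV[R]_n)) _ _ (open_near oD D0) small.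
have [r /= r0 Br] := (nbhs_ballP _ _).1 NN.
pose psi z : 'rV[R]_n := z - F z.
have r20 : 0 < r / 2 by rewrite divr_gt0.
have B z : `|z| <= r / 2 -> ball (0 : 'rV[R]_n) r z.
  move=> zr; rewrite -ball_normE /ball_/= sub0r normrN (le_lt_trans zr)//.
  by rewrite ltr_pdivrMr// ltr_pMr// ltr1n.
have lip y z : `|y| <= r / 2 -> `|z| <= r / 2 -> `|psi y - psi z| <= 2^-1 * `|y - z|.
  move=> yr zr; apply: ler_norm_coords => [|j]; first by rewrite mulr_ge0// invr_ge0.
  have -> : (psi y - psi z) 0 j = ps j y - ps j z by rewrite !mxE.
  have L := @lipschitz_partial R n (ps j) 0 r e (ltW e0).
  apply: (le_trans (L _ y z (B y yr) (B z zr))) => [w Bw i|].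
    have [Dw sw] := Br w Bw; have [d dE] := dps w i j Dw; split; first exact: d.
    by rewrite dE; exact: (sw (i, j)).
  rewrite ler_wpM2r// /e mulrA ler_pdivrMr// mulrC ler_pM2l ?invr_gt0//.
  by rewrite lerDl.
have psi0 : psi 0 = 0 by rewrite /psi F0 subrr.
exists (r / 2 / 2); first by rewrite divr_gt0.
move=> y yr; have [z zr zE] := contraction_onto r20 psi0 lip yr.
exists z; first by have [] := Br z (B z zr).
by rewrite -zE /psi opprB addrCA subrr addr0.
Qed.

End LocalSurjectivity.

Section Surjectivity.
Context {R : realType} {m n : nat} {G : lieGroupType R m}.

Local Notation iphi a := (chart_inv (chart_at a)).
Local Notation coord1 := (@coord1 R m G).

Variable Phi : G -> 'rV[R]_n.
Hypotheses (sPhi : smooth_fun Phi) (PhiM : forall x y : G, Phi (x * y)%g = Phi x + Phi y).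
Variable (A' : 'M[R]_(n, m)).
Hypothesis A'K : A' *m hom_jacobian Phi (1%g : G) = 1%:M.

Lemma hom_surjective (y : 'rV[R]_n) : exists p, Phi p = y.
Proof.
have Phi1 : Phi 1%g = 0.
  by apply: (addrI (Phi 1%g)); rewrite -PhiM mulg1 addr0.
(* Because [A'] is a section of the differential of [Phi] at 1, the restriction [F] of [Phi] to this
   affine slice has the identity as differential at 0. *)
pose L (z : 'rV[R]_n) : 'rV[R]_m := coord1 + z *m A'.
have dL z : differentiable L z.
  by apply: differentiableD => //; exact: mulmx_differentiable.
have cL : continuous L by move=> z; exact: differentiable_continuous.
have TL (h : R) v z : L (h *: v + z) = h *: (v *m A') + L z.
  by rewrite /L mulmxDl -scalemxAl addrCA.
pose F := (Phi \o iphi (1%g : G)) \o L.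
pose D := L @^-1` (chart_img (chart_at (1%g : G))).
have CF : Ck_on 1 D F by apply: (Ck_on_comp_affine cL TL); exact: sPhi.
have oD : open (D : set ('rV[R]_n : normedModType R)).
  apply: open_comp; last exact: img_open.
  by move=> z _; exact: cL.
have L0 : L 0 = coord1 by rewrite /L mul0mx addr0.
have D0 : D 0 by rewrite /D /= L0; exact: chart_center_img.
have F0 : F 0 = 0 by rewrite /F /= L0 chart_centerK.
have DF v : 'D_v F 0 = v.
  have -> : 'D_v F 0 = 'D_(v *m A') (Phi \o iphi (1%g : G)) (L 0).
    apply: (congr1 (fun H : R -> 'rV[R]_n => lim (H h @[h --> 0^']))).
    by apply/funext => h; rewrite /F /= TL.
  by rewrite L0 -[LHS]/(dfun Phi 1%g (v *m A')) dfun_hom// -mulmxA A'K mulmx1.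
have [r r0 H] := locally_onto oD D0 CF F0 DF.
(* Large enough that [N%:R^-1 *: y] has norm at most [r]; the [N]-th power of a preimage of it is
   then a preimage of [y]. *)
pose N := (Num.trunc (`|y| / r)).+1.
have N0 : 0 < N%:R :> R by rewrite ltr0n.
have [|z _ zE] := H (N%:R^-1 *: y).
  rewrite normrZ gtr0_norm ?invr_gt0// mulrC ler_pdivrMr// mulrC -ler_pdivrMr//.
  exact/ltW/truncnS_gt.
exists (iphi (1%g : G) (L z) ^+ N)%g.
have -> : y = (N%:R^-1 *: y) *+ N.
  by rewrite -scaler_nat scalerA mulfV ?gt_eqF// scale1r.
rewrite -zE /F /=; elim: N {N0 zE} => [|k IH]; first by rewrite expg0 Phi1 mulr0n.
by rewrite expgS PhiM IH mulrS.
Qed.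

End Surjectivity.

(** * The orthogonal family *)

Lemma row_dotC (F : comNzRingType) n (x y : 'rV[F]_n) : (x *m y^T) 0 0 = (y *m x^T) 0 0.
Proof. by rewrite !mxE; apply: eq_bigr => k _; rewrite !mxE mulrC. Qed.

Section ComplexParts.
Context {R : realType} {n : nat}.
Local Open Scope complex_scope.
Implicit Types (x : 'rV[R]_n) (v : 'rV[R[i]]_n).

Definition re_row v : 'rV[R]_n := \row_k complex.Re (v 0 k).
Definition im_row v : 'rV[R]_n := \row_k complex.Im (v 0 k).

Lemma complex_rowE (k : nat) (M : 'M[R]_(n, k)) v j :
  (re_row v *m M) 0 j +i* (im_row v *m M) 0 j = (v *m map_mx (real_complex R) M) 0 j.
Proof.
rewrite !mxE.
transitivity (\sum_l (re_row v 0 l * M l j +i* (im_row v 0 l * M l j))).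
  by elim/big_rec3: _ => // l a b c _ <-.
apply: eq_bigr => l _; rewrite !mxE; case: (v 0 l) => a b /=.
by simpc.
Qed.

Lemma bilinE (z w : 'rV[R[i]]_n) : bilin z w = (z *m w^T) 0 0.
Proof. by rewrite mxE; apply: eq_bigr => k _; rewrite mxE. Qed.

Lemma bilin_realE x v : bilin (map_mx (real_complex R) x) v =
  (x *m (re_row v)^T) 0 0 +i* (x *m (im_row v)^T) 0 0.
Proof.
by rewrite !(row_dotC x) complex_rowE bilinE row_dotC map_trmx.
Qed.

(** The rows of [M] are orthonormal for [g], and the complex bilinear extension preserves this. *)
Lemma complex_gram m (M : 'M[R]_(n, m)) (g : 'M[R]_m) v (w : 'rV[R[i]]_n) :
  M *m g *m M^T = 1%:M ->
  v *m map_mx (real_complex R) M *m map_mx (real_complex R) g *m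
    (w *m map_mx (real_complex R) M)^T = v *m w^T.
Proof.
move=> MM; rewrite trmx_mul map_trmx.
transitivity (v *m (map_mx (real_complex R) M *m map_mx (real_complex R) g *m
  map_mx (real_complex R) M^T) *m w^T); first by rewrite !mulmxA.
by rewrite -!map_mxM MM map_mx1 mulmx1.
Qed.

End ComplexParts.

Section HarmonicFamily.
Context {R : realType} {m n : nat} {G : lieGroupType R m}.

Local Notation phi a := (chart_fun (chart_at a)).
Local Notation iphi a := (chart_inv (chart_at a)).

Variable Phi : G -> 'rV[R]_n.
Hypotheses (sPhi : smooth_fun Phi) (PhiM : forall x y : G, Phi (x * y)%g = Phi x + Phi y).

Definition hom_component (a : 'rV[R]_n) : G -> R^o := fun x => (Phi x *m a^T) 0 0.

Lemma hom_component_smooth a : smooth_fun (hom_component a).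
Proof.
move=> p k.
apply: (@Ck_on_mulmx _ _ k (chart_img (chart_at p)) _ _ _ (Phi \o iphi p) (fun=> a^T)
  (@img_open _ _ _ p)) => i j; last exact: Ck_on_cst.
by apply: Ck_on_coord; [exact: img_open|exact: sPhi].
Qed.

Lemma hom_componentM a (x y : G) :
  hom_component a (x * y)%g = hom_component a x + hom_component a y.
Proof. by rewrite /hom_component PhiM mulmxDl mxE. Qed.

Lemma dfun_hom_component a p i :
  dfun (hom_component a) p (delta_mx 0 i) = (a *m (hom_jacobian Phi p)^T) 0 i.
Proof.
have Ip := chart_center_img p.
have df := smooth_row_differentiable sPhi Ip.
have dP := @diff_derivable _ _ _ _ _ (delta_mx 0 i) df.
have d1 : mxderivable i (Phi \o iphi p) (phi p p).
  by move=> u v; exact: (proj1 (derivable_mxP _ _ (delta_mx 0 i)) dP u v).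
have d2 : mxderivable i (fun=> a^T) (phi p p) by move=> u v; exact: derivable_cst.
have E := mxpartialM d1 d2.
rewrite mxpartial_cst mulmx0 addr0 in E.
have E1 : mxpartial i (Phi \o iphi p) (phi p p) = delta_mx 0 i *m hom_jacobian Phi p.
  by rewrite -dfun_hom// /dfun (derive_mx dP).
apply: (etrans (esym (mxpartialE i (fun y => (Phi \o iphi p) y *m a^T) (phi p p) 0 0))).
by rewrite E E1 -mulmxA -rowE !mxE; apply: eq_bigr => k _; rewrite !mxE mulrC.
Qed.

Lemma grad_hom_component (g : riemannian_metric G) a p :
  grad g (hom_component a) p = a *m ((hom_jacobian Phi p)^T *m invmx (g p)).
Proof.
rewrite /grad mulmxA; congr (_ *m _); apply/rowP => i.
by rewrite mxE dfun_hom_component.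
Qed.

Lemma gradC_hom (g : riemannian_metric G) p (v : 'rV[R[i]%C]_n) :
  gradC g (fun x => bilin (map_mx (real_complex R) (Phi x)) v) p =
  v *m map_mx (real_complex R) ((hom_jacobian Phi p)^T *m invmx (g p)).
Proof.
apply/rowP => k; rewrite mxE -complex_rowE -!grad_hom_component.
rewrite (_ : re_part _ = hom_component (re_row v)); last first.
  by apply/funext => x; rewrite /re_part bilin_realE.
rewrite (_ : im_part _ = hom_component (im_row v)) //.
by apply/funext => x; rewrite /im_part bilin_realE.
Qed.

Lemma kappa_hom (g : riemannian_metric G) p (v w : 'rV[R[i]%C]_n) :
  riemannian_submersion g Phi ->
  kappa g (fun x => bilin (map_mx (real_complex R) (Phi x)) v)
    (fun x => bilin (map_mx (real_complex R) (Phi x)) w) p = bilin v w.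
Proof.
move=> [_ _ sur iso].
have uw i : {u : 'rV[R]_m | dfun Phi p u = delta_mx 0 i} by apply/cid/sur.
(* The rows are preimages of the standard basis under the differential of [Phi] at [p]. *)
pose B' : 'M[R]_(n, m) := \matrix_i sval (uw i).
have BK : B' *m hom_jacobian Phi p = 1%:M.
  by apply/row_matrixP => i; rewrite row_mul rowK -dfun_hom// (svalP (uw i)) rowE mulmx1.
have gr := submersion_gram (Defs.metric_sym g p) (metric_pos g p) BK.
have {}gr : (hom_jacobian Phi p)^T *m invmx (g p) *m hom_jacobian Phi p = 1%:M.
  apply: gr => u u' hu hu'.
  have H (z : 'rV[R]_m) :
      (forall w : 'rV_m, w *m hom_jacobian Phi p = 0 -> (z *m g p *m w^T) 0 0 = 0) ->
      horizontal g Phi p z.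
    by move=> hz z'; rewrite dfun_hom//; exact: hz.
  by have := iso p u u' (H u hu) (H u' hu'); rewrite !dfun_hom.
(* The rows of [M] are the gradients of the coordinates of [Phi]; [gr] makes them orthonormal. *)
set M := (hom_jacobian Phi p)^T *m invmx (g p) in gr.
have MM : M *m g p *m M^T = 1%:M.
  by rewrite trmx_mul trmxK trmx_inv Defs.metric_sym mulmxKV ?metric_pt_unit// mulmxA.
by rewrite /kappa !gradC_hom -/M bilinE complex_gram.
Qed.

Lemma tau_hom (g : riemannian_metric G) p (v : 'rV[R[i]%C]_n) :
  nilpotent_lie_group G -> left_invariant g ->
  tau g (fun x => bilin (map_mx (real_complex R) (Phi x)) v) p = 0.
Proof.
move=> nilG lg; rewrite /tau.
rewrite (_ : re_part _ = hom_component (re_row v)); last first.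
  by apply/funext => x; rewrite /re_part bilin_realE.
rewrite (_ : im_part _ = hom_component (im_row v)); last first.
  by apply/funext => x; rewrite /im_part bilin_realE.
rewrite !laplacian_hom//; [exact: hom_component_smooth|exact: hom_componentM|
  exact: hom_component_smooth|exact: hom_componentM].
Qed.

Lemma smooth_funC_hom (v : 'rV[R[i]%C]_n) :
  smooth_funC (fun x => bilin (map_mx (real_complex R) (Phi x)) v).
Proof.
split.
  rewrite (_ : re_part _ = hom_component (re_row v)); first exact: hom_component_smooth.
  by apply/funext => x; rewrite /re_part bilin_realE.
rewrite (_ : im_part _ = hom_component (im_row v)); first exact: hom_component_smooth.
by apply/funext => x; rewrite /im_part bilin_realE.
Qed.

End HarmonicFamily.

Theorem theorem6p2 (R : realType) (m n : nat) (G : lieGroupType R m)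
    (connG : connected [set: G])
    (sconnG : simply_connected R G)
    (nonabG : ~ (forall x y : G, (x * y)%g = (y * x)%g))
    (nilG : nilpotent_lie_group G)
    (psi : set 'rV[R]_m -> 'rV[R]_n)
    (psi_iso : quotient_iso (derived_algebra G) psi)
    (Phi : G -> 'rV[R]_n)
    (Phi_nat : natural_epimorphism psi Phi) :
  (exists g : riemannian_metric G,
     left_invariant g /\ riemannian_submersion g Phi) /\
  (forall g : riemannian_metric G,
     left_invariant g -> riemannian_submersion g Phi ->
     forall V : {vspace 'rV[R[i]%C]_n}, maximal_isotropic V ->
       orthogonal_family g (Omega Phi V)).
Proof.
have [sPhi PhiM dPhi] := Phi_nat.
split; last first.
  move=> g lg rs V [isoV _]; split.
    move=> _ [v vV ->]; split; first exact: smooth_funC_hom.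
      by move=> p; exact: tau_hom.
    by move=> p; rewrite kappa_hom//; exact: isoV.
  by move=> _ _ [v vV ->] [w wV ->] p; rewrite kappa_hom//; exact: isoV.
have [_ _ sur] := psi_iso.
have uw i : {u : 'rV[R]_m | psi (coset (derived_algebra G) u) = delta_mx 0 i}.
  exact/cid/sur.
(* Its rows represent the classes that [psi] sends to the standard basis, which gives a linear
   section of the differential of [Phi] at 1. *)
pose A' : 'M[R]_(n, m) := \matrix_i sval (uw i).
have A'K : A' *m hom_jacobian Phi (1%g : G) = 1%:M.
  apply/row_matrixP => i; rewrite row_mul rowK -dfun_hom// dPhi (svalP (uw i)).
  by rewrite rowE mulmx1.
exists (natural_metric Phi A'); split; first exact: left_invariant_metricP.
apply: natural_metric_submersion => //; exact: hom_surjective A'K.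
Qed.
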